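(* Let $k>0$, $c\in\mathbb{R}$, $x>0$, and let $\alpha,\eta,\lambda,v\in\mathbb{C}$ be such that $\Re(v)>-1$, $\Re(\alpha)>0$, $\Re(\lambda+v)>0$ and $\frac{\lambda}{k}+\frac{v}{k}+\eta\notin\{0,-1,-2,\dots\}$, and suppose that none of the three lower parameters of the ${}_2F_3$ below is in $\{0,-1,-2,\dots\}$. Then $$\left(K_{\eta,\alpha}^{+}\,t^{\frac{\lambda}{k}-1}W_{v,c}^{k}(t)\right)(x)=\frac{x^{\frac{\lambda}{k}+\frac{v}{k}-1}}{(2k)^{\frac{v}{k}}}\,\frac{\Gamma\left(\frac{\lambda}{k}+\frac{v}{k}+\eta\right)}{\Gamma\left(\frac{\lambda}{k}+\frac{v}{k}+\alpha+\eta\right)\Gamma\left(\frac{v}{k}+1\right)}\;{}_2F_3\left[\begin{array}{c}\frac{\lambda}{2k}+\frac{v}{2k}+\frac{\eta}{2},\ \frac{\lambda}{2k}+\frac{v}{2k}+\frac{\eta+1}{2}\\ \frac{v}{k}+1,\ \frac{\lambda}{2k}+\frac{v}{2k}+\frac{\alpha+\eta}{2},\ \frac{\lambda}{2k}+\frac{v}{2k}+\frac{\alpha+\eta+1}{2}\end{array};-\frac{cx^2}{4k}\right].$$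
   Context: The left-sided Erdélyi–Kober fractional integral is, for $x>0$, $\alpha,\eta\in\mathbb{C}$, $\Re(\alpha)>0$, $$\left(K_{\eta,\alpha}^{+}f\right)(x)=\frac{x^{-\alpha-\eta}}{\Gamma(\alpha)}\int_0^x (x-t)^{\alpha-1}t^{\eta}f(t)\,dt.$$ The notation $\left(K_{\eta,\alpha}^{+}g(t)\right)(x)$ means the operator applied to $t\mapsto g(t)$ on $(0,\infty)$ and evaluated at $x$. The $k$-Bessel function is $$W_{v,c}^{k}(z)=\sum_{n=0}^{\infty}\frac{(-c)^n}{\Gamma_k(nk+v+k)\,n!}\left(\frac{z}{2}\right)^{2n+\frac{v}{k}},$$ where $\Gamma_k(z)=\int_0^\infty t^{z-1}e^{-t^k/k}\,dt$ for $\Re(z)>0$, extended by $\Gamma_k(z)=k^{\frac{z}{k}-1}\Gamma\left(\frac{z}{k}\right)$. The generalized hypergeometric function is $${}_pF_q\left[\begin{array}{c}a_1,\dots,a_p\\ b_1,\dots,b_q\end{array};z\right]=\sum_{n=0}^\infty\frac{(a_1)_n\cdots(a_p)_n}{(b_1)_n\cdots(b_q)_n}\frac{z^n}{n!},\qquad b_j\ne0,-1,-2,\dots,$$ where $(a)_n$ is the Pochhammer symbol. Complex powers of positive reals are $y^s=e^{s\log y}$.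
   Formalization: The identity is stated whenever the integral on the left converges absolutely, with convergence proved if Re(λ/k+v/k+η)>0; the stated hypotheses allow Re(λ/k+v/k+η)≤0, where the integral diverges (e.g. k=1, v=0, λ=1, η=−3/2, α=1). *)

(* Defs.v *)
From HB Require Import structures.
From mathcomp Require Import all_boot all_order all_algebra.
From mathcomp Require Import all_classical all_reals all_analysis.
From mathcomp.real_closed Require Import complex.

Set Implicit Arguments.
Unset Strict Implicit.
Unset Printing Implicit Defensive.

Import Order.TTheory GRing.Theory Num.Theory.
Import numFieldNormedType.Exports.

Local Open Scope classical_set_scope.
Local Open Scope ring_scope.
Local Open Scope complex_scope.

Section Defs.
Context {R : realType}.
Implicit Types (a s z : R[i]) (k c t x y : R) (n : nat).

Definition cexp z : R[i] :=
  (expR (complex.Re z))%:C *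
  (cos (complex.Im z) +i* sin (complex.Im z)).

(* y^s = e^(s log y); only meaningful for y > 0. *)
Definition cpow y s : R[i] := cexp (s * (ln y)%:C).

(* Lebesgue integrability and integral of a complex-valued function; on a
   function that is not integrable the value of [cintegral] is junk. *)
Definition cintegrable (D : set R) (f : R -> R[i]) : Prop :=
  lebesgue_measure.-integrable D (fun t => (complex.Re (f t))%:E) /\
  lebesgue_measure.-integrable D (fun t => (complex.Im (f t))%:E).

Definition cintegral (D : set R) (f : R -> R[i]) : R[i] :=
  (Rintegral lebesgue_measure D (fun t => complex.Re (f t))) +i*
  (Rintegral lebesgue_measure D (fun t => complex.Im (f t))).

Definition cseries_sum (u : nat -> R[i]) : R[i] :=
  (lim (series (fun n => complex.Re (u n)) @ \oo)) +i*
  (lim (series (fun n => complex.Im (u n)) @ \oo)).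

Definition pochhammer a n : R[i] := \prod_(i < n) (a + i%:R).

Definition nonpos_integer z : Prop := exists n, z = - n%:R.

Definition Gamma_integral z : R[i] :=
  cintegral `]0, +oo[ (fun t => cpow t (z - 1) * (expR (- t))%:C).

(* For Re z <= 0, with n the least natural number such that Re z + n > 0, this
   is the continuation Gamma z = Gamma (z + n) / (z (z + 1) ... (z + n - 1)).
   The value at a pole is 0, because 0^-1 = 0. *)
Definition Gamma z : R[i] :=
  if 0 < complex.Re z then Gamma_integral z
  else let n := (Num.truncn (- complex.Re z)).+1 in
       Gamma_integral (z + n%:R) / pochhammer z n.

Definition Gammak k z : R[i] :=
  if 0 < complex.Re z then
    cintegral `]0, +oo[ (fun t => cpow t (z - 1) * (expR (- (t `^ k / k)))%:C)
  else cpow k (z / k%:C - 1) * Gamma (z / k%:C).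

Definition kBessel k (v : R[i]) c t : R[i] :=
  cseries_sum (fun n =>
    ((- c) ^+ n)%:C / (Gammak k (n%:R * k%:C + v + k%:C) * (n`!)%:R)
    * cpow (t / 2) ((2 * n)%:R + v / k%:C)).

(* p = size a and q = size b. *)
Definition pFq (a b : seq R[i]) z : R[i] :=
  cseries_sum (fun n =>
    (\prod_(ai <- a) pochhammer ai n) / (\prod_(bj <- b) pochhammer bj n)
    * (z ^+ n / (n`!)%:R)).

Definition EK_integrand (eta alpha : R[i]) (f : R -> R[i]) x t : R[i] :=
  cpow (x - t) (alpha - 1) * cpow t eta * f t.

(* f is in the domain of the operator K^+_(eta, alpha) at x. *)
Definition EK_defined (eta alpha : R[i]) (f : R -> R[i]) x : Prop :=
  cintegrable `]0, x[ (EK_integrand eta alpha f x).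

Definition EK (eta alpha : R[i]) (f : R -> R[i]) x : R[i] :=
  cpow x (- alpha - eta) / Gamma alpha
  * cintegral `]0, x[ (EK_integrand eta alpha f x).

End Defs.

(* Main.v *)
Require Import Defs.
From HB Require Import structures.
From mathcomp Require Import all_boot all_order all_algebra.
From mathcomp Require Import all_classical all_reals all_analysis.
From mathcomp.real_closed Require Import complex.
From mathcomp Require Import measurable_realfun ring lra.

Import Order.TTheory GRing.Theory Num.Theory.
Import numFieldNormedType.Exports Normc.

(** Near the origin the k-Bessel function is [t^(v/k)] times an entire function
    of [t^2], so the Erdélyi-Kober integrand is, up to a constant factor,

          (x - t)^(alpha - 1) t^(m - 1) sum_n w_n t^(2n),
          m = lambda/k + v/k + eta.

    When [Re m > 0] the series may be integrated term by term: on [0, x] its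
    partial sums are dominated by the integrable weight times the convergent
    series of the [|w_n| x^(2n)] ([cintegral_series]). Each term is a Beta
    integral ([beta_integral]),

          x^(alpha + m + 2n - 1) Gamma(alpha) Gamma(m + 2n) / Gamma(alpha + m + 2n),

    and writing [Gamma(a + 2n)] as [4^n (a/2)_n ((a+1)/2)_n Gamma(a)]
    ([pochhammer_double]) turns the sum into the 2F3 series.

    The condition [Re m > 0] is equivalent to integrability: since [v/k + 1] is
    not a pole of Gamma, the leading coefficient of the k-Bessel series does not
    vanish, and for [Re m <= 0] the modulus of the integrand is at least a
    multiple of [1/t] near the origin ([bessel_kernel_integrable_gt0]). This gives
    both halves of the theorem.

    The Gamma function is developed from its integral. All changes of variable
    are instances of one substitution rule for increasing maps onto the positive
    half-line ([integral_param]). The functional equation comes from the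
    vanishing boundary values of [t^z e^(-t)] ([Gamma_integral_rec]). The Beta
    integral comes from Fubini's theorem applied to
    [r^(b-1) t^(a+b-1) e^(-(1+r)t)] ([Gamma_integral_mul]); dividing by
    [Gamma(a + b)] there requires that Gamma has no zeros, and this is obtained by
    a second moment estimate: for [z = N + i tau] with [N] large the density
    [t^(N-1) e^(-t)] is concentrated around [t = N], where the oscillating factor
    [t^(i tau)] is almost constant ([Gamma_integral_neq0_far]); the functional
    equation carries the conclusion back to all [z] with [Re z > 0]. *)

Local Open Scope classical_set_scope.
Local Open Scope ring_scope.
Local Open Scope complex_scope.

Local Notation Rpart := complex.Re.
Local Notation Ipart := complex.Im.

(** * Complex exponentials and moduli *)

Section ComplexAlgebra.
Context {R : realType}.
Implicit Types (z w s : R[i]) (x y a : R) (n : nat).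

Lemma RpartD z w : Rpart (z + w) = Rpart z + Rpart w.
Proof. by case: z; case: w. Qed.

Lemma IpartD z w : Ipart (z + w) = Ipart z + Ipart w.
Proof. by case: z; case: w. Qed.

Lemma RpartN z : Rpart (- z) = - Rpart z.
Proof. by case: z. Qed.

Lemma IpartN z : Ipart (- z) = - Ipart z.
Proof. by case: z. Qed.

Lemma RpartM z w : Rpart (z * w) = Rpart z * Rpart w - Ipart z * Ipart w.
Proof. by case: z; case: w. Qed.

Lemma IpartM z w : Ipart (z * w) = Rpart z * Ipart w + Ipart z * Rpart w.
Proof. by case: z; case: w. Qed.

Lemma RpartMr z a : Rpart (z * a%:C) = Rpart z * a.
Proof. by rewrite RpartM /= mulr0 subr0. Qed.

Lemma IpartMr z a : Ipart (z * a%:C) = Ipart z * a.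
Proof. by rewrite IpartM /= mulr0 add0r. Qed.

Lemma Rpart_nat n : Rpart (n%:R : R[i]) = n%:R.
Proof. by rewrite -(rmorph_nat (real_complex R)). Qed.

Lemma Ipart_nat n : Ipart (n%:R : R[i]) = 0.
Proof. by rewrite -(rmorph_nat (real_complex R)). Qed.

Lemma eq_complexRI z w : Rpart z = Rpart w -> Ipart z = Ipart w -> z = w.
Proof. by case: z w => [? ?] [? ?] /= -> ->. Qed.

Lemma cexpD z w : cexp (z + w) = cexp z * cexp w.
Proof.
rewrite /cexp RpartD IpartD expRD cosD sinD.
apply: eq_complexRI; rewrite !(RpartM, IpartM) /=; ring.
Qed.

Lemma cexp_real a : cexp a%:C = (expR a)%:C.
Proof. by rewrite /cexp /= cos0 sin0 mulr1. Qed.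

Lemma cexp0 : cexp (0 : R[i]) = 1.
Proof. by rewrite (cexp_real 0) expR0. Qed.

Lemma cexpN z : cexp (- z) = (cexp z)^-1.
Proof.
have e1 : cexp (- z) * cexp z = 1 by rewrite -cexpD addNr cexp0.
have nz : cexp z != 0.
  by apply/eqP => e; move: e1; rewrite e mulr0 => /esym/eqP; rewrite oner_eq0.
by apply: (mulIf nz); rewrite e1 mulVf.
Qed.

Lemma normc_real a : normc a%:C = `|a|.
Proof. by rewrite /normc /= expr0n addr0 sqrtr_sqr. Qed.

Lemma normc_cexp z : normc (cexp z) = expR (Rpart z).
Proof.
rewrite /cexp normcM normc_real ger0_norm ?expR_ge0//.
by rewrite [X in _ * X]/= cos2Dsin2 sqrtr1 mulr1.
Qed.

Lemma cexp_neq0 z : cexp z != 0.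
Proof.
apply/eqP => /(congr1 (@normc R)); rewrite normc_cexp normc0.
by apply/eqP; rewrite gt_eqF ?expR_gt0.
Qed.

Lemma cpowD y s w : cpow y (s + w) = cpow y s * cpow y w.
Proof. by rewrite /cpow mulrDl cexpD. Qed.

Lemma cpowN y s : cpow y (- s) = (cpow y s)^-1.
Proof. by rewrite /cpow mulNr cexpN. Qed.

Lemma cpow_neq0 y s : cpow y s != 0.
Proof. exact: cexp_neq0. Qed.

Lemma cpow_real y a : 0 < y -> cpow y a%:C = (y `^ a)%:C.
Proof.
move=> y0; rewrite /cpow -rmorphM cexp_real /powR.
by rewrite gt_eqF.
Qed.

Lemma cpow_nat y n : 0 < y -> cpow y n%:R = (y ^+ n)%:C.
Proof.
move=> y0; rewrite -(rmorph_nat (real_complex R)) cpow_real// powR_mulrn//.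
exact: ltW.
Qed.

Lemma cpow1 y : 0 < y -> cpow y 1 = y%:C.
Proof. by move=> y0; rewrite (cpow_nat _ 1)// expr1. Qed.

Lemma cpowM x y s : 0 < x -> 0 < y -> cpow (x * y) s = cpow x s * cpow y s.
Proof. by move=> x0 y0; rewrite /cpow lnM// rmorphD/= mulrDr cexpD. Qed.

Lemma cpowV x s : 0 < x -> cpow x^-1 s = (cpow x s)^-1.
Proof. by move=> x0; rewrite /cpow lnV// rmorphN/= mulrN cexpN. Qed.

Lemma cpow_powR y a s : 0 < y -> cpow (y `^ a) s = cpow y (a%:C * s).
Proof.
by move=> y0; rewrite /cpow ln_powR rmorphM/= [_ * s]mulrC mulrA.
Qed.

Lemma normc_cpow y s : normc (cpow y s) = expR (Rpart s * ln y).
Proof. by rewrite /cpow normc_cexp RpartMr. Qed.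

Lemma normc_cpow_gt0 y s : 0 < y -> normc (cpow y s) = y `^ Rpart s.
Proof. by move=> y0; rewrite normc_cpow /powR gt_eqF. Qed.

Lemma Rpart_le_normc z : `|Rpart z| <= normc z.
Proof.
case: z => a b /=; rewrite -sqrtr_sqr ler_wsqrtr// lerDl sqr_ge0//.
Qed.

Lemma Ipart_le_normc z : `|Ipart z| <= normc z.
Proof.
case: z => a b /=; rewrite -sqrtr_sqr ler_wsqrtr// lerDr sqr_ge0//.
Qed.

Lemma normc_ge0 z : 0 <= normc z.
Proof. by case: z => a b; exact: sqrtr_ge0. Qed.

Lemma normc_le_ReIm z : normc z <= `|Rpart z| + `|Ipart z|.
Proof.
have -> : z = (Rpart z)%:C + 'i * (Ipart z)%:C by rewrite -complexE.
apply: (le_trans (le_normcD _ _)).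
rewrite normcM !normc_real !(RpartD, IpartD, RpartM, IpartM) /=.
rewrite expr0n expr1n add0r sqrtr1 mul1r.
by rewrite !(mul0r, mulr0, mul1r, subr0, addr0, add0r).
Qed.

End ComplexAlgebra.

(** * Integration of complex-valued functions *)

Section ComplexIntegration.
Context {R : realType}.
Notation mu := (@lebesgue_measure R).

Definition cmeasurable {d} {T : measurableType d} (D : set T) (f : T -> R[i]) :=
  measurable_fun D (fun t => Rpart (f t)) /\
  measurable_fun D (fun t => Ipart (f t)).

Section Cmeasurable.
Context {d} {T : measurableType d}.
Implicit Types (D : set T) (f g : T -> R[i]) (h : T -> R).

Lemma cmeasurable_cst D (z : R[i]) : cmeasurable D (fun=> z).
Proof. by split; exact: measurable_cst. Qed.

Lemma cmeasurable_real D h : measurable_fun D h ->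
  cmeasurable D (fun t => (h t)%:C).
Proof. by move=> mh; split => //=; exact: measurable_cst. Qed.

Lemma cmeasurableD D f g : cmeasurable D f -> cmeasurable D g ->
  cmeasurable D (fun t => f t + g t).
Proof.
move=> [mf1 mf2] [mg1 mg2]; split.
  by under eq_fun do rewrite RpartD; exact: measurable_funD.
by under eq_fun do rewrite IpartD; exact: measurable_funD.
Qed.

Lemma cmeasurableM D f g : cmeasurable D f -> cmeasurable D g ->
  cmeasurable D (fun t => f t * g t).
Proof.
move=> [mf1 mf2] [mg1 mg2]; split.
  by under eq_fun do rewrite RpartM; apply: measurable_funB; exact: measurable_funM.
by under eq_fun do rewrite IpartM; apply: measurable_funD; exact: measurable_funM.
Qed.

Lemma cmeasurable_sum D (F : nat -> T -> R[i]) n :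
  (forall i, cmeasurable D (F i)) ->
  cmeasurable D (fun t => \sum_(0 <= i < n) F i t).
Proof.
move=> mF; elim: n => [|n IH].
  by under eq_fun do rewrite big_geq//; exact: cmeasurable_cst.
by under eq_fun do rewrite big_nat_recr//=; exact: cmeasurableD.
Qed.

Lemma cmeasurable_cpow D h (s : R[i]) : measurable_fun D h ->
  cmeasurable D (fun t => cpow (h t) s).
Proof.
move=> mh; have ml : measurable_fun D (fun t => ln (h t)).
  exact: measurableT_comp (@measurable_ln R) mh.
have mle : measurable_fun D (fun t => expR (Rpart s * ln (h t))).
  by apply: measurableT_comp => //; exact: measurable_funM.
have mcs : measurable_fun D (fun t => Ipart s * ln (h t)).
  by apply: measurable_funM.
rewrite /cpow /cexp; split.
- under eq_fun do rewrite RpartM RpartMr IpartMr /= mul0r subr0.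
  apply: measurable_funM => //; apply: measurableT_comp mcs.
  by apply: continuous_measurable_fun; exact: continuous_cos.
- under eq_fun do rewrite IpartM RpartMr IpartMr /= mul0r addr0.
  apply: measurable_funM => //; apply: measurableT_comp mcs.
  by apply: continuous_measurable_fun; exact: continuous_sin.
Qed.

Lemma measurable_normc D f : cmeasurable D f ->
  measurable_fun D (fun t => normc (f t)).
Proof.
move=> [m1 m2].
have -> : (fun t => normc (f t)) =
    (@Num.sqrt R) \o (fun t => Rpart (f t) ^+ 2 + Ipart (f t) ^+ 2).
  by apply/funext => t /=; case: (f t).
apply: measurableT_comp; last by apply: measurable_funD; exact: measurable_funX.
by apply: continuous_measurable_fun; exact: sqrt_continuous.
Qed.

End Cmeasurable.

Implicit Types (D : set R) (f g : R -> R[i]).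

Lemma cintegrable_le D f (h : R -> R) : measurable D -> cmeasurable D f ->
  mu.-integrable D (fun t => (h t)%:E) ->
  (forall t, D t -> normc (f t) <= h t) -> cintegrable D f.
Proof.
move=> mD [m1 m2] ih fh; split.
- apply: le_integrable ih => //; first exact/measurable_EFinP.
  move=> t Dt; rewrite !abse_EFin lee_fin.
  by apply: (le_trans (Rpart_le_normc _)); apply: (le_trans (fh _ Dt)); rewrite ler_norm.
- apply: le_integrable ih => //; first exact/measurable_EFinP.
  move=> t Dt; rewrite !abse_EFin lee_fin.
  by apply: (le_trans (Ipart_le_normc _)); apply: (le_trans (fh _ Dt)); rewrite ler_norm.
Qed.

Lemma cintegrable_measurable D f : cintegrable D f -> cmeasurable D f.
Proof.
move=> [/(measurable_int mu)/measurable_EFinP m1].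
by move=> /(measurable_int mu)/measurable_EFinP m2; split.
Qed.

Lemma cintegrable_normc D f : measurable D -> cintegrable D f ->
  mu.-integrable D (fun t => (normc (f t))%:E).
Proof.
move=> mD cf; have mf := cintegrable_measurable _ _ cf; case: cf => i1 i2.
have : mu.-integrable D (fun t : R => `|(Rpart (f t))%:E| + `|(Ipart (f t))%:E|)%E.
  by apply: integrableD => //; exact: integrable_abse.
apply: le_integrable => //.
  by apply/measurable_EFinP; exact: measurable_normc.
move=> t Dt; rewrite /= lee_fin.
rewrite ger0_norm ?normc_ge0// ger0_norm; first exact: normc_le_ReIm.
by rewrite addr_ge0.
Qed.

Lemma cintegrableP D f : measurable D -> cmeasurable D f ->
  cintegrable D f <-> (\int[mu]_(t in D) (normc (f t))%:E < +oo)%E.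
Proof.
move=> mD mf; split.
  by move=> /(cintegrable_normc _ _ mD); exact: integrable_lty.
move=> foo; apply: (cintegrable_le D f (fun t => normc (f t))) => //.
apply/integrableP; split; first by apply/measurable_EFinP; exact: measurable_normc.
under eq_integral do rewrite abse_EFin ger0_norm ?normc_ge0//.
exact: foo.
Qed.

Lemma eq_cintegral D f g : {in D, f =1 g} -> cintegral D f = cintegral D g.
Proof.
by move=> fg; rewrite /cintegral; congr Complex; apply: eq_Rintegral => t tD; rewrite fg.
Qed.

Lemma eq_cintegrable D f g : measurable D -> {in D, f =1 g} ->
  cintegrable D f -> cintegrable D g.
Proof.
move=> mD fg [i1 i2]; split.
  by apply: eq_integrable i1 => // t tD; rewrite fg.
by apply: eq_integrable i2 => // t tD; rewrite fg.
Qed.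

Lemma cintegrableZ D (z : R[i]) f : measurable D -> cintegrable D f ->
  cintegrable D (fun t => z * f t).
Proof.
move=> mD cf; have mf := cintegrable_measurable _ _ cf.
apply: (cintegrable_le D _ (fun t => normc z * normc (f t))) => //.
- by apply: cmeasurableM => //; exact: cmeasurable_cst.
- under eq_fun do rewrite EFinM.
  by apply: integrableZl => //; exact: cintegrable_normc.
- by move=> t _; rewrite normcM.
Qed.

Lemma cintegralZ D (z : R[i]) f : measurable D -> cintegrable D f ->
  cintegral D (fun t => z * f t) = z * cintegral D f.
Proof.
move=> mD [i1 i2].
have iZ (r : R) (g : R -> R) : mu.-integrable D (fun t => (g t)%:E) ->
    mu.-integrable D (EFin \o (fun t => r * g t)).
  move=> ig; suff : mu.-integrable D (fun t : R => r%:E * (g t)%:E)%E by [].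
  exact: integrableZl.
rewrite /cintegral; apply: eq_complexRI.
- rewrite RpartM /=; under eq_Rintegral do rewrite RpartM.
  by rewrite RintegralB ?RintegralZl//; exact: iZ.
- rewrite IpartM /=; under eq_Rintegral do rewrite IpartM.
  by rewrite RintegralD ?RintegralZl//; exact: iZ.
Qed.

Lemma cintegrableD D f g : measurable D -> cintegrable D f -> cintegrable D g ->
  cintegrable D (fun t => f t + g t).
Proof.
move=> mD [f1 f2] [g1 g2]; split.
  by under eq_fun do rewrite RpartD EFinD; exact: integrableD.
by under eq_fun do rewrite IpartD EFinD; exact: integrableD.
Qed.

Lemma cintegralD D f g : measurable D -> cintegrable D f -> cintegrable D g ->
  cintegral D (fun t => f t + g t) = cintegral D f + cintegral D g.
Proof.
move=> mD [f1 f2] [g1 g2]; rewrite /cintegral; apply: eq_complexRI.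
- by rewrite RpartD /=; under eq_Rintegral do rewrite RpartD; rewrite RintegralD.
- by rewrite IpartD /=; under eq_Rintegral do rewrite IpartD; rewrite RintegralD.
Qed.

Lemma Rpart_sum (F : nat -> R[i]) n :
  Rpart (\sum_(0 <= i < n) F i) = \sum_(0 <= i < n) Rpart (F i).
Proof. by elim: n => [|n IH]; [rewrite !big_geq|rewrite !big_nat_recr//= RpartD IH]. Qed.

Lemma Ipart_sum (F : nat -> R[i]) n :
  Ipart (\sum_(0 <= i < n) F i) = \sum_(0 <= i < n) Ipart (F i).
Proof. by elim: n => [|n IH]; [rewrite !big_geq|rewrite !big_nat_recr//= IpartD IH]. Qed.

Lemma normc_sum (F : nat -> R[i]) n :
  normc (\sum_(0 <= i < n) F i) <= \sum_(0 <= i < n) normc (F i).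
Proof.
elim: n => [|n IH]; first by rewrite !big_geq// normc0.
by rewrite !big_nat_recr//=; apply: (le_trans (le_normcD _ _)); rewrite lerD2r.
Qed.

Lemma cintegrable_sum D (F : nat -> R -> R[i]) n : measurable D ->
  (forall i, cintegrable D (F i)) ->
  cintegrable D (fun t => \sum_(0 <= i < n) F i t).
Proof.
move=> mD iF; elim: n => [|n IH].
  under eq_fun do rewrite big_geq//.
  by split => /=; exact: integrable0.
by under eq_fun do rewrite big_nat_recr//=; exact: cintegrableD.
Qed.

Lemma cintegral_sum D (F : nat -> R -> R[i]) n : measurable D ->
  (forall i, cintegrable D (F i)) ->
  cintegral D (fun t => \sum_(0 <= i < n) F i t) =
  \sum_(0 <= i < n) cintegral D (F i).
Proof.
move=> mD iF; elim: n => [|n IH].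
  rewrite big_geq//; under eq_cintegral do rewrite big_geq//.
  by rewrite /cintegral /Rintegral /= integral0.
rewrite big_nat_recr//= -IH -cintegralD//; last exact: cintegrable_sum.
by apply: eq_cintegral => t _; rewrite big_nat_recr.
Qed.

(** [cseries_sum] takes limits component by component, so this is the convergence
    under which its value is meaningful. *)
Definition csummable (u : nat -> R[i]) :=
  cvgn (series (fun n => Rpart (u n))) /\ cvgn (series (fun n => Ipart (u n))).

Lemma csummable_le (u : nat -> R[i]) (c : nat -> R) :
  cvgn (series c) -> (forall n, normc (u n) <= c n) -> csummable u.
Proof.
move=> cc uc; have c0 n : 0 <= c n by apply: le_trans (normc_ge0 _) (uc n).
split; apply: normed_cvg; apply: (series_le_cvg _ c0 _ cc) => n //=.
  by apply: le_trans (Rpart_le_normc _) (uc n).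
by apply: le_trans (Ipart_le_normc _) (uc n).
Qed.

(** Multiplication by [z] mixes the real and imaginary parts, so both component
    series have to converge. *)
Lemma csummable_sumZ (z : R[i]) (u : nat -> R[i]) : csummable u ->
  cseries_sum (fun n => z * u n) = z * cseries_sum u.
Proof.
move=> [c1 c2].
have ZE (a : R) (v : nat -> R) : cvgn (series v) ->
    series (fun n => a * v n) @ \oo --> a * limn (series v).
  move=> cv; rewrite (_ : series _ = (fun n => a * series v n)); last first.
    by apply/funext => n; rewrite /series /= big_distrr.
  exact: cvgMr.
rewrite /cseries_sum; apply: eq_complexRI.
- rewrite RpartM /=; apply/cvg_lim => //.
  rewrite (_ : series _ = (series (fun n => Rpart z * Rpart (u n)) -
    series (fun n => Ipart z * Ipart (u n)))); first by apply: cvgB; exact: ZE.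
  apply/funext => n; rewrite /series /= fctE -sumrB.
  by apply: eq_bigr => i _; rewrite RpartM.
- rewrite IpartM /=; apply/cvg_lim => //.
  rewrite (_ : series _ = (series (fun n => Rpart z * Ipart (u n)) +
    series (fun n => Ipart z * Rpart (u n)))); first by apply: cvgD; exact: ZE.
  apply/funext => n; rewrite /series /= fctE -big_split.
  by apply: eq_bigr => i _; rewrite IpartM.
Qed.

Lemma Rdominated_convergence (D : set R) (f_ : nat -> R -> R) (f g : R -> R) :
  measurable D -> (forall n, measurable_fun D (f_ n)) ->
  (forall t, D t -> f_ n t @[n --> \oo] --> f t) ->
  mu.-integrable D (fun t => (g t)%:E) ->
  (forall n t, D t -> `|f_ n t| <= g t) ->
  mu.-integrable D (fun t => (f t)%:E) /\
  (\int[mu]_(t in D) f_ n t @[n --> \oo] --> \int[mu]_(t in D) f t).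
Proof.
move=> mD mf_ ff ig fg.
have mf_E n : measurable_fun D (EFin \o f_ n) by exact/measurable_EFinP.
have ffE t : D t -> ((f_ n t)%:E @[n --> \oo] --> (f t)%:E)%E.
  by move=> Dt; apply: cvg_EFin; [exact: nearW|exact: ff].
have mf : measurable_fun D (EFin \o f) by apply: (emeasurable_fun_cvg _ _ mf_E).
have [] := @dominated_convergence _ _ _ mu D mD
  (fun n => EFin \o f_ n) (EFin \o f) (EFin \o g) mf_E mf.
- by apply: aeW => t Dt; exact: ffE.
- exact: ig.
- by apply: aeW => t n Dt /=; rewrite lee_fin fg.
move=> If _ L; split; first exact: If.
apply: fine_cvg; rewrite fineK; last exact: integrable_fin_num.
exact: L.
Qed.

(** The bound [c n * h t] separates the variables, so all partial sums are
    dominated by [(\sum_n c n) * h] and dominated convergence applies. *)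
Lemma cintegral_series D (F : nat -> R -> R[i]) (c : nat -> R) (h : R -> R) :
  measurable D -> (forall n, cmeasurable D (F n)) ->
  mu.-integrable D (fun t => (h t)%:E) -> cvgn (series c) ->
  (forall n, 0 <= c n) -> (forall t, D t -> 0 <= h t) ->
  (forall n t, D t -> normc (F n t) <= c n * h t) ->
  [/\ cintegrable D (fun t => cseries_sum (F ^~ t)),
      csummable (fun n => cintegral D (F n)) &
      cseries_sum (fun n => cintegral D (F n)) =
      cintegral D (fun t => cseries_sum (F ^~ t))].
Proof.
move=> mD mF ih cc c0 h0 Fch.
have iF n : cintegrable D (F n).
  apply: (cintegrable_le D _ (fun t => c n * h t)) => //; last exact: Fch.
  by under eq_fun do rewrite EFinM; exact: integrableZl.
have sF t : D t -> csummable (F ^~ t).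
  move=> Dt; apply: (csummable_le _ (fun n => c n * h t)); last by move=> n; exact: Fch.
  rewrite (_ : series _ = (fun n => series c n * h t)); last first.
    by apply/funext => n; rewrite /series /= big_distrl.
  by apply: is_cvgMl.
pose C := limn (series c).
have cC n : series c n <= C.
  apply: nondecreasing_cvgn_le => //; apply: nondecreasing_series => i _ _; exact: c0.
have bound n t : D t -> normc (\sum_(0 <= i < n) F i t) <= C * h t.
  move=> Dt; apply: (le_trans (normc_sum _ _)).
  apply: (@le_trans _ _ (series c n * h t)); last by rewrite ler_wpM2r// h0.
  by rewrite /series /= big_distrl /=; apply: ler_sum => i _; exact: Fch.
have iCh : mu.-integrable D (fun t : R => (C * h t)%:E).
  by under eq_fun do rewrite EFinM; exact: integrableZl.
have mS n := cmeasurable_sum D F n mF.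
have [I1 L1] : mu.-integrable D (fun t => (Rpart (cseries_sum (F ^~ t)))%:E) /\
    (\int[mu]_(t in D) (Rpart (\sum_(0 <= i < n) F i t)) @[n --> \oo] -->
    \int[mu]_(t in D) Rpart (cseries_sum (F ^~ t))).
  apply: (Rdominated_convergence _ _ _ (fun t => C * h t)) => //.
  - by move=> n; case: (mS n).
  - move=> t Dt; rewrite (_ : (fun n => _) = series (fun n => Rpart (F n t))).
      by have [+ _] := sF t Dt.
    by apply/funext => n; rewrite Rpart_sum.
  - by move=> n t Dt; apply: (le_trans (Rpart_le_normc _)); exact: bound.
have [I2 L2] : mu.-integrable D (fun t => (Ipart (cseries_sum (F ^~ t)))%:E) /\
    (\int[mu]_(t in D) (Ipart (\sum_(0 <= i < n) F i t)) @[n --> \oo] -->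
    \int[mu]_(t in D) Ipart (cseries_sum (F ^~ t))).
  apply: (Rdominated_convergence _ _ _ (fun t => C * h t)) => //.
  - by move=> n; case: (mS n).
  - move=> t Dt; rewrite (_ : (fun n => _) = series (fun n => Ipart (F n t))).
      by have [_ +] := sF t Dt.
    by apply/funext => n; rewrite Ipart_sum.
  - by move=> n t Dt; apply: (le_trans (Ipart_le_normc _)); exact: bound.
have E1 : (fun n => \int[mu]_(t in D) (Rpart (\sum_(0 <= i < n) F i t))) =
    series (fun n => Rpart (cintegral D (F n))).
  apply/funext => n.
  rewrite -[LHS]/(Rpart (cintegral D (fun t => \sum_(0 <= i < n) F i t))).
  by rewrite cintegral_sum// Rpart_sum.
have E2 : (fun n => \int[mu]_(t in D) (Ipart (\sum_(0 <= i < n) F i t))) =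
    series (fun n => Ipart (cintegral D (F n))).
  apply/funext => n.
  rewrite -[LHS]/(Ipart (cintegral D (fun t => \sum_(0 <= i < n) F i t))).
  by rewrite cintegral_sum// Ipart_sum.
rewrite E1 in L1; rewrite E2 in L2; split => //.
- by split; [apply: cvgP L1|apply: cvgP L2].
- by rewrite /cseries_sum (cvg_lim _ L1)// (cvg_lim _ L2).
Qed.

End ComplexIntegration.

(** * Changes of variable onto the positive half-line *)

Section Substitution.
Context {R : realType}.
Notation mu := (@lebesgue_measure R).

Local Notation posR := (`]0%R, +oo[%classic : set R).

Section Exhaustion.
Variables (I : set R) (p q : nat -> R).
Hypothesis pq : forall n, p n <= q n.
Hypothesis ndpq : nondecreasing_seq (fun n => `[p n, q n]%classic).
Hypothesis IE : I = \bigcup_n `[p n, q n]%classic.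
Hypothesis oI : open I.
Variables phi dphi : R -> R.
Hypothesis phi_gt0 : forall t, I t -> 0 < phi t.
Hypothesis phi_surj : forall y, 0 < y -> exists2 t, I t & phi t = y.
Hypothesis phi_incr : forall s t, I s -> I t -> s < t -> phi s < phi t.
Hypothesis dphiE : forall t, I t -> is_derive t 1 phi (dphi t).
Hypothesis dphi_cont : forall t, I t -> {for t, continuous dphi}.
Hypothesis dphi_ge0 : forall t, I t -> 0 <= dphi t.

Let segI n t : t \in `[p n, q n] -> I t.
Proof. by move=> tn; rewrite IE; exists n. Qed.

Let derive1_phi t : I t -> derive1 phi t = dphi t.
Proof. by move=> It; rewrite derive1E; have [_ ->] := dphiE t It. Qed.

Let cont_derive1 t : I t -> {for t, continuous (derive1 phi)}.
Proof.
move=> It; have := dphi_cont t It; rewrite /prop_for /continuous_at.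
rewrite derive1_phi// => ct; apply: cvg_trans ct; apply: near_eq_cvg.
have : nbhs t I by exact: open_nbhs_nbhs.
by apply: filterS => s Is; rewrite derive1_phi.
Qed.

Let cont_phi t : I t -> {for t, continuous phi}.
Proof.
move=> It; apply: differentiable_continuous; apply/derivable1_diffP.
by have [] := dphiE t It.
Qed.

Let image_cover : posR = \bigcup_n `[phi (p n), phi (q n)]%classic.
Proof.
have le_phi s t : I s -> I t -> s <= t -> phi s <= phi t.
  by move=> Is It; rewrite le_eqVlt => /predU1P[->//|st]; exact/ltW/phi_incr.
apply/seteqP; split => y /=; rewrite ?in_itv/= ?andbT.
  move=> /phi_surj[t It <-]; have : I t by [].
  rewrite {1}IE => -[n _ /= tn]; exists n => //=; rewrite in_itv/=.
  have := tn; rewrite in_itv/= => /andP[pt tq].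
  by rewrite !le_phi//; apply: (segI n); rewrite in_itv/= lexx pq.
move=> [n _]; rewrite /= in_itv/= => /andP[+ _]; apply: lt_le_trans.
by apply: phi_gt0; apply: (segI n); rewrite in_itv/= lexx pq.
Qed.

Let measurable_sub (g : R -> R) :
  (forall y, 0 < y -> {for y, continuous g}) ->
  measurable_fun I (fun t => g (phi t) * dphi t).
Proof.
move=> cg; apply: open_continuous_measurable_fun => // t; rewrite inE => It.
apply: continuousM; last exact: dphi_cont.
by apply: continuous_comp; [exact: cont_phi|exact/cg/phi_gt0].
Qed.

(** Monotone convergence along the exhausting segments. *)
Let ge0_subst (g : R -> R) : (forall y, 0 <= g y) ->
  (forall y, 0 < y -> {for y, continuous g}) ->
  (\int[mu]_(y in posR) (g y)%:E = \int[mu]_(t in I) (g (phi t) * dphi t)%:E)%E.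
Proof.
move=> g0 cg.
have Ipq n : I (p n) /\ I (q n).
  by split; apply: (segI n); rewrite in_itv/= lexx pq.
have mI : measurable I by exact: open_measurable.
have L : (\int[mu]_(t in `[p n, q n]) (g (phi t) * dphi t)%:E @[n --> \oo] -->
    \int[mu]_(t in I) (g (phi t) * dphi t)%:E)%E.
  rewrite IE; apply: ge0_nondecreasing_set_cvg_integral => //.
  - move=> n; apply/measurable_EFinP; apply: measurable_funS (measurable_sub _ cg) => //.
    by move=> t; exact: segI.
  - move=> n t tn; rewrite lee_fin mulr_ge0//; apply: dphi_ge0; exact: segI tn.
have L' : (\int[mu]_(y in `[phi (p n), phi (q n)]) (g y)%:E @[n --> \oo] -->
    \int[mu]_(y in posR) (g y)%:E)%E.
  rewrite image_cover; apply: ge0_nondecreasing_set_cvg_integral => //.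
  - move=> m n mn; rewrite subsetEset => y /=.
    rewrite !in_itv/= => /andP[py yq].
    have := ndpq _ _ mn; rewrite subsetEset => sub.
    have le_phi s t : I s -> I t -> s <= t -> phi s <= phi t.
      by move=> Is It; rewrite le_eqVlt => /predU1P[->//|st]; exact/ltW/phi_incr.
    have [Ipm Iqm] := Ipq m; have [Ipn Iqn] := Ipq n.
    have := sub (p m); rewrite /= !in_itv/= lexx pq => /(_ isT)/andP[pp _].
    have := sub (q m); rewrite /= !in_itv/= lexx pq => /(_ isT)/andP[_ qq].
    by rewrite (le_trans _ py) ?le_phi// (le_trans yq) ?le_phi.
  - move=> n; apply/measurable_EFinP.
    apply: (@measurable_funS _ _ _ _ posR) => //.
      by rewrite image_cover => y yn; exists n.
    apply: open_continuous_measurable_fun => // y; rewrite inE /= in_itv/= andbT.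
    exact: cg.
  - by move=> n y _; rewrite lee_fin.
rewrite -(cvg_lim _ L')// -(cvg_lim _ L)//; congr (lim (_ @ \oo)).
apply/funext => n; have [Ipn Iqn] := Ipq n.
rewrite integration_by_substitution_increasing//.
- apply: eq_integral => t; rewrite inE /= => tn.
  by rewrite -(derive1_phi t (segI _ _ tn)).
- by move=> s t /segI Is /segI It; exact: phi_incr.
- move=> t tn; apply: cont_derive1; apply: (segI n).
  exact: subset_itv_oo_cc tn.
- by apply/cvg_ex; eexists; apply: cvg_at_right_filter; exact: cont_derive1.
- by apply/cvg_ex; eexists; apply: cvg_at_left_filter; exact: cont_derive1.
- split.
  + move=> t /subset_itv_oo_cc/segI It; by have [] := dphiE t It.
  + by apply: cvg_at_right_filter; exact: cont_phi.
  + by apply: cvg_at_left_filter; exact: cont_phi.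
- apply: continuous_in_subspaceT => y; rewrite inE /= in_itv/= => /andP[py _].
  by apply: cg; apply: lt_le_trans py; exact: phi_gt0.
Qed.

(** Splitting [g] into positive and negative parts reduces to [ge0_subst]. The
    equality is between extended integrals, so that it transports integrability
    as well as values. *)
Lemma integral_subst (g : R -> R) :
  (forall y, 0 < y -> {for y, continuous g}) ->
  (\int[mu]_(y in posR) (g y)%:E = \int[mu]_(t in I) (g (phi t) * dphi t)%:E)%E.
Proof.
move=> cg; rewrite integralE [RHS]integralE.
have maxc (h : R -> R) y : {for y, continuous h} ->
    {for y, continuous (fun x => Num.max (h x) 0)}.
  by move=> ch; apply: (@continuous_max _ _ h (cst 0)) => //; exact: cst_continuous.
congr (_ - _)%E.
- transitivity (\int[mu]_(y in posR) (Num.max (g y) 0)%:E)%E.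
    by apply: eq_integral => y _; rewrite funeposE EFin_max.
  rewrite ge0_subst; last 2 first.
  + by move=> y; rewrite le_max lexx orbT.
  + by move=> y y0; apply: maxc; exact: cg.
  apply: eq_integral => t; rewrite inE => It; rewrite funeposE -EFin_max.
  by rewrite maxr_pMl ?mul0r// dphi_ge0.
- transitivity (\int[mu]_(y in posR) (Num.max (- g y) 0)%:E)%E.
    by apply: eq_integral => y _; rewrite funenegE EFin_max.
  rewrite ge0_subst; last 2 first.
  + by move=> y; rewrite le_max lexx orbT.
  + by move=> y y0; apply: (maxc (fun x => - g x)); apply: continuousN; exact: cg.
  apply: eq_integral => t; rewrite inE => It; rewrite funenegE -EFinN -EFin_max.
  by rewrite maxr_pMl ?mul0r ?mulNr// dphi_ge0.
Qed.

End Exhaustion.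

Definition ccontinuous_at (f : R -> R[i]) (t : R) :=
  {for t, continuous (fun u => Rpart (f u))} /\
  {for t, continuous (fun u => Ipart (f u))}.

Lemma eq_continuous_for (f g : R -> R) t :
  f =1 g -> {for t, continuous f} -> {for t, continuous g}.
Proof. by move=> /funext ->. Qed.

Lemma ccontinuousM (f g : R -> R[i]) t :
  ccontinuous_at f t -> ccontinuous_at g t ->
  ccontinuous_at (fun u => f u * g u) t.
Proof.
move=> [f1 f2] [g1 g2]; split.
  apply: (eq_continuous_for
    (fun u => Rpart (f u) * Rpart (g u) - Ipart (f u) * Ipart (g u))) => [u|].
    by rewrite RpartM.
  by apply: continuousB; exact: continuousM.
apply: (eq_continuous_for
  (fun u => Rpart (f u) * Ipart (g u) + Ipart (f u) * Rpart (g u))) => [u|].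
  by rewrite IpartM.
by apply: continuousD; exact: continuousM.
Qed.

Lemma ccontinuous_cst (z : R[i]) t : ccontinuous_at (fun=> z) t.
Proof. by split; exact: cst_continuous. Qed.

Lemma ccontinuous_real (h : R -> R) t : {for t, continuous h} ->
  ccontinuous_at (fun u => (h u)%:C) t.
Proof. by move=> ch; split => //=; exact: cst_continuous. Qed.

Lemma ccontinuous_cpow (h : R -> R) (s : R[i]) t :
  {for t, continuous h} -> 0 < h t -> ccontinuous_at (fun u => cpow (h u) s) t.
Proof.
move=> ch h0.
have cl (a : R) : {for t, continuous (fun u => a * ln (h u))}.
  apply: continuousM; first exact: cst_continuous.
  by apply: continuous_comp => //; exact: continuous_ln.
have ce : {for t, continuous (fun u => expR (Rpart s * ln (h u)))}.
  by apply: continuous_comp; [exact: cl|exact: continuous_expR].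
rewrite /cpow /cexp; split.
- apply: (eq_continuous_for
    (fun u => expR (Rpart s * ln (h u)) * cos (Ipart s * ln (h u)))) => [u|].
    by rewrite RpartM RpartMr IpartMr /= mul0r subr0.
  apply: continuousM => //.
  by apply: continuous_comp; [exact: cl|exact: continuous_cos].
- apply: (eq_continuous_for
    (fun u => expR (Rpart s * ln (h u)) * sin (Ipart s * ln (h u)))) => [u|].
    by rewrite IpartM RpartMr IpartMr /= mul0r addr0.
  apply: continuousM => //.
  by apply: continuous_comp; [exact: cl|exact: continuous_sin].
Qed.

Lemma continuous_normc (f : R -> R[i]) t : ccontinuous_at f t ->
  {for t, continuous (fun u => normc (f u))}.
Proof.
move=> [c1 c2].
apply: (eq_continuous_for
    ((@Num.sqrt R) \o (fun u => Rpart (f u) ^+ 2 + Ipart (f u) ^+ 2))) => [u|].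
  by rewrite /=; case: (f u).
apply: continuous_comp; last exact: sqrt_continuous.
by apply: continuousD; apply: continuousM.
Qed.

Lemma ccontinuous_measurable (D : set R) (f : R -> R[i]) : open D ->
  (forall t, D t -> ccontinuous_at f t) -> cmeasurable D f.
Proof.
move=> oD cf; split.
  by apply: open_continuous_measurable_fun => // t; rewrite inE => /cf[].
by apply: open_continuous_measurable_fun => // t; rewrite inE => /cf[].
Qed.

(** The substitution rule and the fundamental theorem of calculus live on segments;
    an open interval is reached as an increasing union of them. *)
Definition exhaustible (I : set R) := open I /\ exists p q : nat -> R,
  [/\ forall n, p n <= q n,
      nondecreasing_seq (fun n => `[p n, q n]%classic) &
      I = \bigcup_n `[p n, q n]%classic].

Lemma posR_cover :
  [/\ forall n, n.+2%:R^-1 < n.+2%:R :> R,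
      nondecreasing_seq (fun n => `[n.+2%:R^-1 : R, n.+2%:R]%classic) &
      posR = \bigcup_n `[n.+2%:R^-1 : R, n.+2%:R]%classic].
Proof.
split => [n|m n mn|].
- by rewrite (@lt_le_trans _ _ 1)// ?invf_lt1 ?ltr1n ?ler1n ?ltr0n.
- rewrite subsetEset => t /=; rewrite !in_itv/= => /andP[t1 t2].
  rewrite (le_trans _ t1) ?(le_trans t2) ?ler_nat ?ltnS//.
  by rewrite lef_pV2 ?posrE ?ltr0n// ler_nat !ltnS.
- apply/seteqP; split => t /=; rewrite in_itv/= ?andbT.
    move=> t0; exists (Num.truncn (t^-1 + t)) => //=; rewrite in_itv/=.
    have b0 : t^-1 + t <= (Num.truncn (t^-1 + t)).+2%:R.
      apply: (@le_trans _ _ (Num.truncn (t^-1 + t)).+1%:R).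
        by rewrite ltW// truncnS_gt.
      by rewrite ler_nat.
    apply/andP; split.
      rewrite -[leRHS]invrK lef_pV2 ?posrE ?invr_gt0 ?ltr0n//.
      by apply: le_trans b0; rewrite lerDl ltW.
    by apply: le_trans b0; rewrite lerDr invr_ge0 ltW.
  by move=> [n _] /=; rewrite in_itv/= => /andP[+ _]; apply: lt_le_trans; rewrite invr_gt0.
Qed.

Lemma exhaustible_posR : exhaustible posR.
Proof.
split; first exact: interval_open.
have [pq nd E] := posR_cover.
by exists (fun n => n.+2%:R^-1), (fun n => n.+2%:R); split => // n; exact/ltW.
Qed.

Lemma exhaustible_oo (x : R) : 0 < x -> exhaustible `]0, x[%classic.
Proof.
move=> x0; split; first exact: interval_open.
have p0 n : 0 < x / n.+2%:R by rewrite divr_gt0.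
exists (fun n => x / n.+2%:R), (fun n => x - x / n.+2%:R); split => [n|m n mn|].
- have : x / n.+2%:R <= x / 2.
    by rewrite ler_wpM2l ?(ltW x0)// lef_pV2 ?posrE ?ltr0n// ler_nat.
  by move: (x / n.+2%:R) => y ?; lra.
- rewrite subsetEset => t /=; rewrite !in_itv/= => /andP[t1 t2].
  have xx : x / n.+2%:R <= x / m.+2%:R.
    by rewrite ler_wpM2l ?(ltW x0)// lef_pV2 ?posrE ?ltr0n// ler_nat !ltnS.
  by rewrite (le_trans xx t1) (le_trans t2)// lerB.
- apply/seteqP; split => t /=; rewrite in_itv/=.
    move=> /andP[t0 tx]; exists (Num.truncn (x / t + x / (x - t))) => //=.
    rewrite in_itv/=; set N := Num.truncn _.
    have xt0 : 0 < x - t by rewrite subr_gt0.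
    have b0 : x / t + x / (x - t) <= N.+2%:R.
      apply: (@le_trans _ _ N.+1%:R); first by rewrite ltW// truncnS_gt.
      by rewrite ler_nat.
    have key u : 0 < u -> x / u <= N.+2%:R -> x / N.+2%:R <= u.
      by move=> u0; rewrite ler_pdivrMr// ler_pdivrMr ?ltr0n// mulrC.
    apply/andP; split.
      by apply: key => //; apply: le_trans b0; rewrite lerDl divr_ge0// ltW.
    rewrite lerBrDl -lerBrDr; apply: key => //.
    by apply: le_trans b0; rewrite lerDr divr_ge0// ltW.
  move=> [n _] /=; rewrite in_itv/= => /andP[t1 t2].
  by rewrite (lt_le_trans _ t1)//= (le_lt_trans t2)// ltrBlDr ltrDl.
Qed.

(** Both [`]0, +oo[] and [`]0, x[] occur as [I]; every integral is transported to
    or from the half-line, which is therefore the only target. *)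
Record parametrization (I : set R) (phi dphi : R -> R) : Prop := Parametrization {
  param_gt0 : forall t, I t -> 0 < phi t ;
  param_surj : forall y, 0 < y -> exists2 t, I t & phi t = y ;
  param_incr : forall s t, I s -> I t -> s < t -> phi s < phi t ;
  param_derive : forall t, I t -> is_derive t 1 phi (dphi t) ;
  param_cont : forall t, I t -> {for t, continuous dphi} ;
  param_ge0 : forall t, I t -> 0 <= dphi t }.

Lemma integral_param (I : set R) (phi dphi g : R -> R) :
  exhaustible I -> parametrization I phi dphi ->
  (forall y, 0 < y -> {for y, continuous g}) ->
  (\int[mu]_(y in posR) (g y)%:E = \int[mu]_(t in I) (g (phi t) * dphi t)%:E)%E.
Proof.
move=> [oI [p [q [pq nd IE]]]] [? ? ? ? ? ?] cg.
exact: (integral_subst I p q).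
Qed.

Lemma cintegral_param (I : set R) (phi dphi : R -> R) (f : R -> R[i]) :
  exhaustible I -> parametrization I phi dphi ->
  (forall y, 0 < y -> ccontinuous_at f y) ->
  cintegral posR f = cintegral I (fun t => f (phi t) * (dphi t)%:C).
Proof.
move=> eI P cf; rewrite /cintegral; congr Complex.
- rewrite /Rintegral (integral_param I phi dphi)//; last by move=> y /cf[].
  by congr fine; apply: eq_integral => t _; rewrite RpartMr.
- rewrite /Rintegral (integral_param I phi dphi)//; last by move=> y /cf[].
  by congr fine; apply: eq_integral => t _; rewrite IpartMr.
Qed.

Lemma cintegrable_param (I : set R) (phi dphi : R -> R) (f : R -> R[i]) :
  exhaustible I -> parametrization I phi dphi ->
  (forall y, 0 < y -> ccontinuous_at f y) ->
  cintegrable posR f <-> cintegrable I (fun t => f (phi t) * (dphi t)%:C).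
Proof.
move=> eI P cf.
have cphi t : I t -> {for t, continuous phi}.
  move=> It; apply: differentiable_continuous; apply/derivable1_diffP.
  by have [] := param_derive _ _ _ P t It.
have m1 : cmeasurable posR f.
  apply: ccontinuous_measurable => [|t]; first exact: interval_open.
  by rewrite /= in_itv/= andbT; exact: cf.
have m2 : cmeasurable I (fun t => f (phi t) * (dphi t)%:C).
  apply: ccontinuous_measurable => [|t It]; first by have [] := eI.
  apply: ccontinuousM; last by apply: ccontinuous_real; exact: (param_cont _ _ _ P).
  have [c1 c2] := cf _ (param_gt0 _ _ _ P t It).
  by split; [exact: (continuous_comp (cphi t It) c1)|
             exact: (continuous_comp (cphi t It) c2)].
have mI : measurable I by apply: open_measurable; have [] := eI.
rewrite cintegrableP// cintegrableP// (integral_param I phi dphi)//; last first.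
  by move=> y y0; apply: continuous_normc; exact: cf.
suff -> : (\int[mu]_(t in I) (normc (f (phi t)) * dphi t)%:E =
  \int[mu]_(t in I) (normc (f (phi t) * (dphi t)%:C))%:E)%E by [].
apply: eq_integral => t; rewrite inE => It; rewrite normcM normc_real ger0_norm//.
exact: (param_ge0 _ _ _ P).
Qed.

Lemma in_posR (t : R) : posR t = (0 < t).
Proof. by rewrite /= in_itv/= andbT. Qed.

Lemma measurable_posR : measurable posR.
Proof. exact: measurable_itv. Qed.

Lemma param_scale (c : R) : 0 < c ->
  parametrization posR (fun t => c * t) (fun=> c).
Proof.
move=> c0; split => [t|y y0|s t _ _ st|t _|t _|t _].
- by rewrite in_posR => t0; rewrite mulr_gt0.
- by exists (y / c); rewrite ?in_posR ?divr_gt0// mulrCA divff ?mulr1// gt_eqF.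
- by rewrite ltr_pM2l.
- have := is_deriveZ (f := id) c; rewrite /GRing.scale /= => H.
  by apply: is_derive_eq; rewrite /GRing.scale /= mulr1.
- exact: cst_continuous.
- exact: ltW.
Qed.

Lemma param_power (a : R) : 0 < a ->
  parametrization posR (fun t => t `^ a / a) (fun t => t `^ (a - 1)).
Proof.
move=> a0; split => [t|y y0|s t|t|t|t]; rewrite ?in_posR.
- by move=> t0; rewrite divr_gt0 ?powR_gt0.
- exists ((a * y) `^ a^-1); first by rewrite in_posR powR_gt0 ?mulr_gt0.
  rewrite -powRrM mulVf ?gt_eqF// powRr1 ?mulr_ge0 ?ltW//.
  by rewrite mulrAC divff ?mul1r// gt_eqF.
- by move=> s0 t0 st; rewrite ltr_pM2r ?invr_gt0// gt0_ltr_powR ?nnegrE ?ltW.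
- move=> t0; have D := is_derive1_powR a t0.
  have E : is_derive t 1 (fun t => t `^ a / a) (a^-1 * (a * t `^ (a - 1))).
    rewrite (_ : (fun t => _) = a^-1 \*: (fun u : R => u `^ a)); last first.
      by apply/funext => u; rewrite /GRing.scale /= mulrC.
    exact: is_deriveZ.
  by apply: is_derive_eq; rewrite mulrA mulVf ?mul1r// gt_eqF.
- move=> t0; apply: differentiable_continuous; apply/derivable1_diffP.
  by have [] := is_derive1_powR (a - 1) t0.
- by move=> _; exact: powR_ge0.
Qed.

(** The map carrying [`]0, x[] to the half-line that turns the Beta integral of the
    second kind into that of the first kind. *)
Lemma param_moebius (x : R) : 0 < x ->
  parametrization `]0, x[%classic (fun t => t / (x - t)) (fun t => x / (x - t) ^+ 2).
Proof.
move=> x0; have inI (t : R) : (`]0, x[%classic : set R) t = (0 < t < x).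
  by rewrite /= in_itv.
split => [t|y y0|s t|t|t|t]; rewrite ?inI.
- by move=> /andP[t0 tx]; rewrite divr_gt0 ?subr_gt0.
- have y1 : 0 < 1 + y by rewrite addr_gt0.
  exists (x * y / (1 + y)).
    rewrite inI divr_gt0 ?mulr_gt0//= ltr_pdivrMr// ltr_pM2l// ltrDr//.
  by field; rewrite !gt_eqF//; nra.
- move=> /andP[s0 sx] /andP[t0 tx] st.
  by rewrite ltr_pdivrMr ?subr_gt0// mulrAC ltr_pdivlMr ?subr_gt0//; nra.
- move=> /andP[t0 tx]; have nz : x - t != 0 by rewrite gt_eqF ?subr_gt0.
  have D1 : is_derive t 1 (fun y : R => x - y) (-1).
    rewrite -[X in is_derive _ _ _ X]sub0r.
    exact: (is_deriveB (f := cst x) (g := id)).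
  have D2 := is_deriveV (f := fun y : R => x - y) nz D1.
  have D3 : is_derive t 1 (fun y => y / (x - y))
      (t *: (- (x - t) ^- 2 *: -1) + (x - t)^-1 *: 1).
    exact: is_deriveM.
  by apply: is_derive_eq; rewrite /GRing.scale /=; field.
- move=> /andP[t0 tx]; have nz : x - t != 0 by rewrite gt_eqF ?subr_gt0.
  apply: continuousM; first exact: cst_continuous.
  apply: continuousV; first by rewrite expf_eq0.
  have cB : {for t, continuous (fun u : R => x - u)}.
    by apply: continuousB; [exact: cst_continuous|exact: cvg_id].
  exact: (continuousM cB cB).
- by move=> _; rewrite divr_ge0 ?sqr_ge0 ?ltW.
Qed.
End Substitution.

(** * The Gamma integral and its functional equation *)

Section GammaIntegral.
Context {R : realType}.
Notation mu := (@lebesgue_measure R).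
Local Notation posR := (`]0%R, +oo[%classic : set R).
Implicit Types (s t : R) (z w : R[i]).

(** Raise [u <= expR u], for [u := e * t / s], to the power [s]. *)
Lemma le_powR_expR (s e t : R) : 0 < s -> 0 < e -> 0 < t ->
  t `^ s <= (s / e) `^ s * expR (e * t).
Proof.
move=> s0 e0 t0; have u0 : 0 < e * t / s by rewrite divr_gt0 ?mulr_gt0.
have -> : t = (s / e) * (e * t / s) by field; rewrite !gt_eqF.
have se0 : 0 < s / e by rewrite divr_gt0.
rewrite powRM ?(ltW u0) ?(ltW se0)// ler_wpM2l ?powR_ge0//.
have -> : e * (s / e * (e * t / s)) = (e * t / s) * s by field; rewrite !gt_eqF.
rewrite expRM ge0_ler_powR ?nnegrE ?expR_ge0 ?(ltW s0) ?(ltW u0)//.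
by apply: le_trans (expR_ge1Dx _); rewrite lerDr.
Qed.

Lemma continuous_inv_sqr (y : R) : 0 < y ->
  {for y, continuous (fun u : R => (1 + u) ^- 2)}.
Proof.
move=> y0; apply: continuousV; first by rewrite expf_eq0/= gt_eqF ?addr_gt0.
have cD : {for y, continuous (fun u : R => 1 + u)}.
  by apply: continuousD; [exact: cst_continuous|exact: cvg_id].
exact: (continuousM cD cD).
Qed.

(** Under [u := t / (1 - t)] the integral becomes the length of [`]0, 1[]. *)
Lemma integral_inv_sqr :
  (\int[mu]_(u in posR) ((1 + u) ^- 2)%:E = 1)%E.
Proof.
rewrite (integral_param `]0%R, 1%R[%classic (fun t => t / (1 - t)) (fun t => 1 / (1 - t) ^+ 2)).
- transitivity (\int[mu]_(t in `]0%R, 1%R[) cst 1%:E t)%E.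
    apply: eq_integral => t; rewrite inE /= in_itv/= => /andP[t0 t1].
    by congr EFin; field; rewrite gt_eqF ?subr_gt0 ?t1//=; apply/eqP; lra.
  by rewrite integral_cst//= mul1e lebesgue_measure_itv/= lte_fin ltr01 sube0.
- exact: exhaustible_oo.
- exact: param_moebius.
- exact: continuous_inv_sqr.
Qed.

(** The dominating function [(1 + t `^ s / s) ^- 2 * t `^ (s - 1)] is what the
    substitution [u := t `^ s / s] makes of [(1 + u) ^- 2], so one integral settles
    both the singularity at [0] and the decay at infinity. *)
Lemma integrable_gamma_real s : 0 < s ->
  mu.-integrable posR (fun t => (t `^ (s - 1) * expR (- t))%:E).
Proof.
move=> s0.
have mg : measurable_fun posR (fun t => t `^ (s - 1) * expR (- t)).
  apply: measurable_funM; apply: measurable_funTS; first exact: measurable_powR.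
  by apply: measurableT_comp.
pose C := (1 + (s / 2^-1) `^ s / s) ^+ 2.
have cont (t : R) : 0 < t ->
    {for t, continuous (fun t : R => (1 + t `^ s / s) ^- 2 * t `^ (s - 1))}.
  move=> t0; have P := param_power s s0.
  apply: continuousM; last by apply: (param_cont _ _ _ P); rewrite in_posR.
  apply: (continuous_comp (f := fun t : R => t `^ s / s) (g := fun u : R => (1 + u) ^- 2)).
    apply: differentiable_continuous; apply/derivable1_diffP.
    by have [] := param_derive _ _ _ P t; rewrite ?in_posR.
  by apply: continuous_inv_sqr; rewrite divr_gt0 ?powR_gt0.
have iD : mu.-integrable posR
    (fun t => (C * ((1 + t `^ s / s) ^- 2 * t `^ (s - 1)))%:E).
  suff : mu.-integrable posR
    (fun t : R => C%:E * ((1 + t `^ s / s) ^- 2 * t `^ (s - 1))%:E)%E by [].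
  apply: integrableZl => //; apply/integrableP; split.
    apply/measurable_EFinP.
    apply: open_continuous_measurable_fun => [|t]; first exact: interval_open.
    by rewrite inE in_posR => t0; exact: cont.
  under eq_integral => t _.
    rewrite abse_EFin ger0_norm; last first.
      by rewrite mulr_ge0 ?powR_ge0// invr_ge0 sqr_ge0.
    over.
  rewrite -(integral_param posR (fun t => t `^ s / s) (fun t => t `^ (s - 1))
    (fun u => (1 + u) ^- 2)) ?integral_inv_sqr ?ltry//.
  - exact: exhaustible_posR.
  - exact: param_power.
  - exact: continuous_inv_sqr.
apply: le_integrable iD => //; first exact/measurable_EFinP.
move=> t; rewrite in_posR => t0.
rewrite !abse_EFin lee_fin !ger0_norm; last 2 first.
- by rewrite mulr_ge0 ?sqr_ge0// mulr_ge0 ?powR_ge0// invr_ge0 sqr_ge0.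
- by rewrite mulr_ge0 ?powR_ge0 ?expR_ge0.
rewrite mulrA [leLHS]mulrC ler_wpM2r ?powR_ge0// expRN.
have q0 : 0 < 1 + t `^ s / s by rewrite ltr_wpDr// divr_ge0 ?powR_ge0 ?ltW.
rewrite ler_pdivlMr ?exprn_gt0// mulrC ler_pdivrMr ?expR_gt0//.
have -> : expR t = expR (2^-1 * t) ^+ 2.
  by rewrite -expRM_natr; congr expR; field.
rewrite -exprMn ler_pXn2r ?nnegrE ?(ltW q0)//; last first.
  by rewrite mulr_ge0 ?expR_ge0// addr_ge0// divr_ge0 ?powR_ge0// ltW.
rewrite mulrDl mul1r lerD//.
  by rewrite -[leLHS]expR0 ler_expR mulr_ge0 ?invr_ge0// ltW.
rewrite mulrAC ler_wpM2r ?invr_ge0 ?(ltW s0)//.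
by apply: le_powR_expR => //; rewrite invr_gt0.
Qed.

Lemma RpartB1 z : Rpart (z - 1) = Rpart z - 1.
Proof. by case: z. Qed.

Lemma normc_cpow_expR z s t : 0 < t ->
  normc (cpow t (z - 1) * (expR (- s))%:C) = t `^ (Rpart z - 1) * expR (- s).
Proof.
move=> t0; rewrite normcM normc_real ger0_norm ?expR_ge0//.
by rewrite normc_cpow_gt0// RpartB1.
Qed.

Lemma ccontinuous_gamma z s t : 0 < t ->
  ccontinuous_at (fun t => cpow t (z - 1) * (expR (- (s * t)))%:C) t.
Proof.
move=> t0; apply: ccontinuousM.
  by apply: (ccontinuous_cpow (fun t => t)) => //; exact: cvg_id.
apply: ccontinuous_real.
apply: (continuous_comp (f := fun t : R => - (s * t)) (g := expR)).
  apply: (@continuousN _ R^o); apply: (continuousM (s := fun=> s)).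
    exact: cst_continuous.
  exact: cvg_id.
exact: continuous_expR.
Qed.

Lemma ccontinuous_gamma1 z t : 0 < t ->
  ccontinuous_at (fun t => cpow t (z - 1) * (expR (- t))%:C) t.
Proof.
move=> /(ccontinuous_gamma z 1).
by rewrite (_ : (fun t => _) = (fun t => cpow t (z - 1) * (expR (- t))%:C))//;
  apply/funext => u; rewrite mul1r.
Qed.

Lemma cintegrable_gamma z : 0 < Rpart z ->
  cintegrable posR (fun t => cpow t (z - 1) * (expR (- t))%:C).
Proof.
move=> z0; apply: (cintegrable_le posR _ (fun t => t `^ (Rpart z - 1) * expR (- t))).
- exact: measurable_posR.
- apply: ccontinuous_measurable; first exact: interval_open.
  by move=> t; rewrite in_posR; exact: ccontinuous_gamma1.
- exact: integrable_gamma_real.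
- by move=> t; rewrite in_posR => t0; rewrite normc_cpow_expR.
Qed.

(** The substitution [t := s * t]. The free parameter [s] is what allows an inner
    integral of a double integral to be evaluated. *)
Lemma gamma_scale z s : 0 < Rpart z -> 0 < s ->
  cintegrable posR (fun t => cpow t (z - 1) * (expR (- (s * t)))%:C) /\
  cintegral posR (fun t => cpow t (z - 1) * (expR (- (s * t)))%:C) =
  cpow s (- z) * Gamma_integral z.
Proof.
move=> z0 s0; have mP := measurable_posR.
have E : {in posR, (fun t => cpow t (z - 1) * (expR (- (s * t)))%:C) =1
    (fun t => cpow s (- z) *
      (cpow (s * t) (z - 1) * (expR (- (s * t)))%:C * s%:C))}.
  move=> t; rewrite inE in_posR => t0.
  rewrite cpowM// cpowN (cpowD s) cpowN cpow1//.
  have s1 : s%:C != 0 :> R[i].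
    by apply/eqP => -[] /eqP; rewrite gt_eqF.
  by field; rewrite s1 cpow_neq0.
have [i1 _] := cintegrable_param posR _ _ (fun t => cpow t (z - 1) * (expR (- t))%:C)
  exhaustible_posR (param_scale s s0) (ccontinuous_gamma1 z).
have {}i1 := i1 (cintegrable_gamma z z0).
split.
  apply: (eq_cintegrable posR (fun t => cpow s (- z) *
      (cpow (s * t) (z - 1) * (expR (- (s * t)))%:C * s%:C))) => //.
    by move=> t tP; rewrite E.
  exact: cintegrableZ.
rewrite (eq_cintegral _ _ _ E) cintegralZ//.
rewrite /Gamma_integral [in RHS](cintegral_param posR (fun t => s * t) (fun=> s))//.
- exact: exhaustible_posR.
- exact: param_scale.
- exact: ccontinuous_gamma1.
Qed.

(** The segment version along an exhaustion, with dominated convergence for the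
    integrals: an integration by parts whose boundary terms are limits. *)
Lemma FTC_exhaustion (I : set R) (p q : nat -> R) (F f : R -> R) (l0 l1 : R) :
  (forall n, p n < q n) -> nondecreasing_seq (fun n => `[p n, q n]%classic) ->
  I = \bigcup_n `[p n, q n]%classic -> open I ->
  (forall t, I t -> is_derive t 1 F (f t)) ->
  (forall t, I t -> {for t, continuous f}) ->
  mu.-integrable I (fun t => (f t)%:E) ->
  F (p n) @[n --> \oo] --> l0 -> F (q n) @[n --> \oo] --> l1 ->
  \int[mu]_(t in I) f t = l1 - l0.
Proof.
move=> pq nd IE oI dF cf intf F0 F1.
have mI : measurable I by exact: open_measurable.
have subI n t : t \in `[p n, q n] -> I t by move=> tn; rewrite IE; exists n.
have mf : measurable_fun I f.
  by apply: open_continuous_measurable_fun => // t; rewrite inE; exact: cf.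
have cF t : I t -> {for t, continuous F}.
  move=> It; apply: differentiable_continuous; apply/derivable1_diffP.
  by have [] := dF t It.
have FTCn n : \int[mu]_(t in `[p n, q n]) f t = F (q n) - F (p n).
  rewrite /Rintegral (continuous_FTC2 (F := F))//.
  - apply: continuous_in_subspaceT => t; rewrite inE /= => tn.
    by apply: cf; exact: (subI n).
  - split.
    + by move=> t /subset_itv_oo_cc/subI/dF [].
    + apply: cvg_at_right_filter; apply: cF; apply: (subI n).
      by rewrite in_itv/= lexx ltW.
    + apply: cvg_at_left_filter; apply: cF; apply: (subI n).
      by rewrite in_itv/= lexx ltW.
  - move=> t /subset_itv_oo_cc/subI/dF D.
    by rewrite derive1E; have [_ ->] := D.
have [_ L] : mu.-integrable I (fun t => (f t)%:E) /\
    (\int[mu]_(t in I) (f \_ `[p n, q n]) t @[n --> \oo] --> \int[mu]_(t in I) f t).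
  apply: (Rdominated_convergence _ _ _ (fun t => `|f t|)) => //.
  - move=> n; apply/measurable_restrict => //.
    by apply: measurable_funS mf => //; exact: subIsetl.
  - move=> t It; have : I t by [].
    rewrite {1}IE => -[m _ tm]; apply: (@cvg_near_cst _ _ (f t)).
    exists m => // n /= mn; rewrite patchE mem_set//.
    by have := nd _ _ mn; rewrite subsetEset; apply.
  - exact: integrable_norm.
  - move=> n t It; rewrite patchE; case: ifP => // _; rewrite normr0//.
have E : (fun n => \int[mu]_(t in I) (f \_ `[p n, q n]) t) =
    (fun n => F (q n) - F (p n)).
  apply/funext => n; rewrite -FTCn -Rintegral_mkcondr; congr Rintegral.
  by apply/seteqP; split => [t []//|t tn]; split => //; exact: (subI n).
rewrite E in L.
have L' : F (q n) - F (p n) @[n --> \oo] --> l1 - l0 by exact: cvgB.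
exact: (cvg_unique _ L L').
Qed.

Lemma is_derive_cpow z t : 0 < t ->
  is_derive t 1 (fun u : R => Rpart (cpow u z)) (Rpart (z * cpow t (z - 1))) /\
  is_derive t 1 (fun u : R => Ipart (cpow u z)) (Ipart (z * cpow t (z - 1))).
Proof.
move=> t0; have nz : t != 0 by rewrite gt_eqF.
have Dln (a : R) : is_derive t 1 (fun u => a * ln u) (a / t).
  have Dl : is_derive t 1 (fun u : R => ln u) t^-1 by exact: is_derive1_ln.
  exact: is_deriveZ.
have De : is_derive t 1 (fun u => expR (Rpart z * ln u))
    (expR (Rpart z * ln t) * (Rpart z / t)).
  exact: (is_derive1_comp (f := expR) (g := fun u : R => Rpart z * ln u)).
have Dc : is_derive t 1 (fun u => cos (Ipart z * ln u))
    (- sin (Ipart z * ln t) * (Ipart z / t)).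
  exact: (is_derive1_comp (f := cos) (g := fun u : R => Ipart z * ln u)).
have Ds : is_derive t 1 (fun u => sin (Ipart z * ln u))
    (cos (Ipart z * ln t) * (Ipart z / t)).
  exact: (is_derive1_comp (f := sin) (g := fun u : R => Ipart z * ln u)).
have RE u : Rpart (cpow u z) = expR (Rpart z * ln u) * cos (Ipart z * ln u).
  by rewrite /cpow /cexp RpartM RpartMr IpartMr /= mul0r subr0.
have IE u : Ipart (cpow u z) = expR (Rpart z * ln u) * sin (Ipart z * ln u).
  by rewrite /cpow /cexp IpartM RpartMr IpartMr /= mul0r addr0.
have cE : cpow t (z - 1) = cpow t z * (t^-1)%:C.
  by rewrite cpowD cpowN cpow1// fmorphV.
split.
- rewrite (_ : (fun u => _) = (fun u => expR (Rpart z * ln u) * cos (Ipart z * ln u))); last first.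
    by apply/funext => u; exact: RE.
  have := is_deriveM De Dc => D; apply: is_derive_eq.
  by rewrite cE RpartM RpartMr IpartMr RE IE /GRing.scale /=; ring.
- rewrite (_ : (fun u => _) = (fun u => expR (Rpart z * ln u) * sin (Ipart z * ln u))); last first.
    by apply/funext => u; exact: IE.
  have := is_deriveM De Ds => D; apply: is_derive_eq.
  by rewrite cE IpartM RpartMr IpartMr RE IE /GRing.scale /=; ring.
Qed.

Lemma cvg_inv_nat2 : (n.+2%:R^-1 : R) @[n --> \oo] --> (0 : R).
Proof. by have := @cvg_harmonic R; rewrite -(cvg_shiftS (@harmonic R)). Qed.

Lemma cvg_inv_pos : (n.+2%:R^-1 : R) @[n --> \oo] --> (0 : R)^'+.
Proof.
move=> P nP.
have near_n : \forall n \near \oo, 0 < (n.+2%:R^-1 : R) -> P (n.+2%:R^-1 : R).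
  exact: (cvg_inv_nat2 _ nP).
suff : \forall n \near \oo, P (n.+2%:R^-1 : R) by [].
by apply: filterS near_n => n; apply; rewrite invr_gt0 ltr0n.
Qed.

(** The boundary terms of the integration by parts for Gamma. *)
Lemma powR_expR_cvg0 (a : R) : 0 < a ->
  (n.+2%:R^-1 : R) `^ a * expR (- n.+2%:R^-1) @[n --> \oo] --> 0 /\
  (n.+2%:R : R) `^ a * expR (- n.+2%:R) @[n --> \oo] --> 0.
Proof.
move=> a0; split.
  apply: (@squeeze_cvgr _ _ _ _ (fun=> 0) (fun n => (n.+2%:R^-1 : R) `^ a)).
  - apply: nearW => n; rewrite mulr_ge0 ?powR_ge0 ?expR_ge0//=.
    by rewrite ler_piMr ?powR_ge0// expR_le1 oppr_le0 invr_ge0.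
  - exact: cvg_cst.
  - exact: (cvg_comp _ _ cvg_inv_pos (powR_cvg0 a0)).
pose C := (a / 2^-1) `^ a.
apply: (@squeeze_cvgr _ _ _ _ (fun=> 0) (fun n => C * 2 * (n.+2%:R^-1 : R))).
- apply: nearW => n; rewrite mulr_ge0 ?powR_ge0 ?expR_ge0//=.
  have : 0 < (n.+2%:R : R) by rewrite ltr0n.
  have h0 : 0 < (2^-1 : R) by rewrite invr_gt0.
  move: (n.+2%:R : R) => t t0.
  have B := le_powR_expR a 2^-1 t a0 h0 t0.
  have E : expR (- (2^-1 * t)) <= 2 * t^-1.
    rewrite expRN -[leRHS]invrK lef_pV2 ?posrE ?expR_gt0 ?invr_gt0 ?divr_gt0//.
    rewrite invf_div; apply: le_trans (expR_ge1Dx _).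
    by rewrite [t / 2]mulrC lerDr.
  rewrite (_ : - t = - (2^-1 * t) - (2^-1 * t)); last by field.
  rewrite expRD -mulrA -/C in B *.
  apply: (@le_trans _ _ (C * expR (2^-1 * t) * (expR (- (2^-1 * t)) * expR (- (2^-1 * t))))).
    by rewrite ler_wpM2r// mulr_ge0 ?expR_ge0.
  rewrite mulrA -(mulrA C) -expRD subrr expR0 mulr1.
  by rewrite ler_wpM2l// /C powR_ge0.
- exact: cvg_cst.
- by rewrite -(mulr0 (C * 2)); apply: cvgMr; exact: cvg_inv_nat2.
Qed.

(** The derivative of [cpow t z * expR (- t)] is the difference of the two
    integrands, and this function tends to [0] at both ends. *)
Lemma Gamma_integral_rec z : 0 < Rpart z ->
  Gamma_integral (z + 1) = z * Gamma_integral z.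
Proof.
move=> z0; pose G t := cpow t z * (expR (- t))%:C.
pose g t := z * (cpow t (z - 1) * (expR (- t))%:C) +
  (-1) * (cpow t (z + 1 - 1) * (expR (- t))%:C).
have z1 : 0 < Rpart (z + 1) by rewrite RpartD addr_gt0.
have mP := @measurable_posR R.
have i1 := cintegrable_gamma z z0; have i2 := cintegrable_gamma (z + 1) z1.
have ig : cintegrable posR g by apply: cintegrableD => //; exact: cintegrableZ.
suff g0 : cintegral posR g = 0.
  have : cintegral posR g = z * Gamma_integral z - Gamma_integral (z + 1).
    rewrite cintegralD//; [|exact: cintegrableZ|exact: cintegrableZ].
    by rewrite !cintegralZ// mulN1r.
  by rewrite g0 => /esym/eqP; rewrite subr_eq0 => /eqP.
have [pq nd PE] := @posR_cover R.
have DG t : 0 < t -> is_derive t 1 (fun u : R => Rpart (G u)) (Rpart (g t)) /\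
    is_derive t 1 (fun u : R => Ipart (G u)) (Ipart (g t)).
  move=> t0; have [D1 D2] := is_derive_cpow z t t0.
  have De : is_derive t 1 (fun u => expR (- u)) (- expR (- t)).
    have := is_derive1_comp (f := expR) (g := fun u : R => - u) (x := t)
      (a := expR (- t)) (b := -1) _ _.
    by rewrite mulrN1; apply; exact: is_deriveNid.
  have gE : g t = z * cpow t (z - 1) * (expR (- t))%:C - G t.
    by rewrite /g /G addrK mulN1r mulrA.
  split.
  - rewrite (_ : (fun u => _) = (fun u => Rpart (cpow u z) * expR (- u))); last first.
      by apply/funext => u; rewrite /G RpartMr.
    have D := is_deriveM D1 De; apply: is_derive_eq.
    by rewrite gE RpartD RpartN /G !RpartMr /GRing.scale /=; ring.
  - rewrite (_ : (fun u => _) = (fun u => Ipart (cpow u z) * expR (- u))); last first.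
      by apply/funext => u; rewrite /G IpartMr.
    have D := is_deriveM D2 De; apply: is_derive_eq.
    by rewrite gE IpartD IpartN /G !IpartMr /GRing.scale /=; ring.
have Gn t : 0 < t -> normc (G t) = t `^ Rpart z * expR (- t).
  by move=> t0; rewrite normcM normc_real ger0_norm ?expR_ge0// normc_cpow_gt0.
have cg t : 0 < t -> ccontinuous_at g t.
  move=> t0; split; have cs w : ccontinuous_at
      (fun t => cpow t (w - 1) * (expR (- t))%:C) t by exact: ccontinuous_gamma1.
  - have [H _] := ccontinuousM _ _ _ (ccontinuous_cst z t) (cs z).
    have [H' _] := ccontinuousM _ _ _ (ccontinuous_cst (-1) t) (cs (z + 1)).
    by apply: (eq_continuous_for _ _ _ _ (continuousD H H')) => u; rewrite /g RpartD.
  - have [_ H] := ccontinuousM _ _ _ (ccontinuous_cst z t) (cs z).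
    have [_ H'] := ccontinuousM _ _ _ (ccontinuous_cst (-1) t) (cs (z + 1)).
    by apply: (eq_continuous_for _ _ _ _ (continuousD H H')) => u; rewrite /g IpartD.
have [L0 L1] := powR_expR_cvg0 (Rpart z) z0.
have lim0 (h : R -> R) (p : nat -> R) : (forall t, `|h t| <= normc (G t)) ->
    (forall n, 0 < p n) -> p n `^ Rpart z * expR (- p n) @[n --> \oo] --> 0 ->
    h (p n) @[n --> \oo] --> 0.
  move=> hG p0 L; apply: norm_cvg0.
  apply: (@squeeze_cvgr _ _ _ _ (fun=> 0) (fun n => p n `^ Rpart z * expR (- p n))) => //.
  - by apply: nearW => n; rewrite normr_ge0 -Gn//= hG.
  - exact: cvg_cst.
have p0 n : 0 < (n.+2%:R^-1 : R) by rewrite invr_gt0.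
have oP : open posR by exact: interval_open.
case: ig => ig1 ig2.
rewrite /cintegral; apply: eq_complexRI => /=.
- rewrite -[RHS](subrr 0).
  apply: (FTC_exhaustion posR _ _ (fun u => Rpart (G u)) _ 0 0 pq nd PE oP).
  + by move=> t; rewrite in_posR => /DG[].
  + by move=> t; rewrite in_posR => /cg[].
  + exact: ig1.
  + by apply: (lim0 (fun u => Rpart (G u))) => // t; exact: Rpart_le_normc.
  + by apply: (lim0 (fun u => Rpart (G u))) => // t; exact: Rpart_le_normc.
- rewrite -[RHS](subrr 0).
  apply: (FTC_exhaustion posR _ _ (fun u => Ipart (G u)) _ 0 0 pq nd PE oP).
  + by move=> t; rewrite in_posR => /DG[].
  + by move=> t; rewrite in_posR => /cg[].
  + exact: ig2.
  + by apply: (lim0 (fun u => Ipart (G u))) => // t; exact: Ipart_le_normc.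
  + by apply: (lim0 (fun u => Ipart (G u))) => // t; exact: Ipart_le_normc.
Qed.

End GammaIntegral.

(** * Fubini's theorem for complex-valued functions *)

Section ComplexFubini.
Context {R : realType}.
Notation mu := (@lebesgue_measure R).

(** The domination [M] of the inner integrals provides the absolute integrability
    on the product; restricting to [A `*` B] by zero brings the statement to the
    whole plane. *)
Lemma Rintegral_Fubini (A B : set R) (G : R -> R -> R) (M : R -> R) :
  measurable A -> measurable B ->
  measurable_fun setT (fun p : R * R => G p.1 p.2) ->
  (forall x, A x -> mu.-integrable B (fun y => (G x y)%:E)) ->
  (forall y, B y -> mu.-integrable A (fun x => (G x y)%:E)) ->
  (forall y, B y -> (\int[mu]_(x in A) `|G x y|%:E <= (M y)%:E)%E) ->
  mu.-integrable B (fun y => (M y)%:E) ->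
  mu.-integrable A (fun x => (\int[mu]_(y in B) G x y)%:E) /\
  \int[mu]_(x in A) \int[mu]_(y in B) G x y =
  \int[mu]_(y in B) \int[mu]_(x in A) G x y.
Proof.
move=> mA mB mG iB iA GM iM.
pose f := (fun p : R * R => (G p.1 p.2)%:E) \_ (A `*` B).
have mf : measurable_fun setT f.
  apply/(measurable_restrictT (fun p : R * R => (G p.1 p.2)%:E)).
    exact: measurableX.
  by apply: measurable_funTS; exact/measurable_EFinP.
have fx x y : A x -> f (x, y) = ((fun y => (G x y)%:E) \_ B) y.
  move=> Ax; rewrite /f !patchE /=; congr (if _ then _ else _).
  by apply/idP/idP => [/set_mem[_ By]|/set_mem By]; apply/mem_set.
have fx0 x y : ~ A x -> f (x, y) = 0%E.
  by move=> nAx; rewrite /f patchE; case: ifPn => // /set_mem[].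
have fy x y : B y -> f (x, y) = ((fun x => (G x y)%:E) \_ A) x.
  move=> By; rewrite /f !patchE /=; congr (if _ then _ else _).
  by apply/idP/idP => [/set_mem[Ax _]|/set_mem Ax]; apply/mem_set.
have fy0 x y : ~ B y -> f (x, y) = 0%E.
  by move=> nBy; rewrite /f patchE; case: ifPn => // /set_mem[].
have FE (x : R) : (\int[mu]_y f (x, y))%E =
    ((fun x : R => (\int[mu]_(y in B) G x y)%:E) \_ A) x.
  rewrite patchE; case: ifPn => [/set_mem Ax|/negP nAx].
    under eq_integral do rewrite fx//.
    rewrite -integral_mkcond /Rintegral fineK//.
    by apply: integrable_fin_num => //; exact: iB.
  by apply: integral0_eq => y _; rewrite fx0// => Ax; apply: nAx; exact: mem_set.
have GE (y : R) : (\int[mu]_x f (x, y))%E =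
    ((fun y : R => (\int[mu]_(x in A) G x y)%:E) \_ B) y.
  rewrite patchE; case: ifPn => [/set_mem By|/negP nBy].
    under eq_integral do rewrite fy//.
    rewrite -integral_mkcond /Rintegral fineK//.
    by apply: integrable_fin_num => //; exact: iA.
  by apply: integral0_eq => x _; rewrite fy0// => By; apply: nBy; exact: mem_set.
have mabsf : measurable_fun setT (abse \o f) by exact: measurableT_comp.
have absF : (\int[mu]_y \int[mu]_x `|f (x, y)| < +oo)%E.
  have iMB : mu.-integrable setT ((fun y => (M y)%:E) \_ B).
    by apply: (proj1 (integrable_mkcond _ _)).
  have /integrableP[_] := iMB; apply: le_lt_trans; apply: ge0_le_integral => //.
  - by move=> y _; exact: integral_ge0.
  - apply: (measurable_fun_fubini_tonelli_G (m1 := mu) (abse \o f)).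
      exact: mabsf.
    by move=> p; exact: abse_ge0.
  - by apply: measurableT_comp => //; exact: (measurable_int mu iMB).
  move=> y _; rewrite patchE; case: ifPn => [/set_mem By|/negP nBy]; last first.
    rewrite integral0_eq ?abse_ge0// => x _; rewrite fy0 ?abse0// => By.
    by apply: nBy; exact: mem_set.
  apply: (@le_trans _ _ (M y)%:E); last by rewrite lee_fin ler_norm.
  apply: le_trans (GM y By); rewrite [leRHS]integral_mkcond.
  rewrite le_eqVlt; apply/orP; left; apply/eqP; apply: eq_integral => x _.
  by rewrite fy// !patchE; case: ifP => // _; rewrite abse0.
have intf : (mu \x mu)%E.-integrable setT f.
  by apply/integrable21ltyP.
split.
  have : mu.-integrable setT (fun x : R => \int[mu]_y f (x, y))%E.
    exact: (integrable_fubini_F intf).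
  rewrite (_ : (fun x : R => _) = (fun x : R => (\int[mu]_(y in B) G x y)%:E) \_ A).
    by apply: (proj2 (integrable_mkcond _ _)).
  by apply/funext => x; exact: FE.
have E : (\int[mu]_x \int[mu]_y f (x, y) = \int[mu]_y \int[mu]_x f (x, y))%E.
  exact: (Fubini intf).
rewrite /Rintegral [in LHS]integral_mkcond [in RHS]integral_mkcond; congr fine.
transitivity (\int[mu]_x \int[mu]_y f (x, y))%E.
  by apply: eq_integral => x _; rewrite FE.
by rewrite E; apply: eq_integral => y _; rewrite GE.
Qed.

(** The integrability of the inner integral is recorded because it is how the second
    Beta integrand is shown to be integrable. *)
Lemma cintegral_Fubini (A B : set R) (F : R -> R -> R[i]) (M : R -> R) :
  measurable A -> measurable B ->
  cmeasurable setT (fun p : R * R => F p.1 p.2) ->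
  (forall x, A x -> cintegrable B (F x)) ->
  (forall y, B y -> cintegrable A (fun x => F x y)) ->
  (forall y, B y -> (\int[mu]_(x in A) (normc (F x y))%:E <= (M y)%:E)%E) ->
  mu.-integrable B (fun y => (M y)%:E) ->
  cintegrable A (fun x => cintegral B (F x)) /\
  cintegral A (fun x => cintegral B (F x)) =
  cintegral B (fun y => cintegral A (fun x => F x y)).
Proof.
move=> mA mB [m1 m2] iB iA FM iM.
have mn y : B y -> measurable_fun A (fun x => (normc (F x y))%:E).
  move=> By; apply/measurable_EFinP/measurable_normc.
  exact/cintegrable_measurable/iA.
have B1 y : B y -> (\int[mu]_(x in A) `|Rpart (F x y)|%:E <= (M y)%:E)%E.
  move=> By; apply: le_trans (FM y By); apply: ge0_le_integral => //.
  - apply/measurable_EFinP; apply: measurableT_comp => //.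
    by have [] := cintegrable_measurable _ _ (iA y By).
  - exact: mn.
  - by move=> x Ax; rewrite lee_fin Rpart_le_normc.
have B2 y : B y -> (\int[mu]_(x in A) `|Ipart (F x y)|%:E <= (M y)%:E)%E.
  move=> By; apply: le_trans (FM y By); apply: ge0_le_integral => //.
  - apply/measurable_EFinP; apply: measurableT_comp => //.
    by have [] := cintegrable_measurable _ _ (iA y By).
  - exact: mn.
  - by move=> x Ax; rewrite lee_fin Ipart_le_normc.
have [I1 E1] := Rintegral_Fubini A B (fun x y => Rpart (F x y)) M mA mB m1
  (fun x Ax => (iB x Ax).1) (fun y By => (iA y By).1) B1 iM.
have [I2 E2] := Rintegral_Fubini A B (fun x y => Ipart (F x y)) M mA mB m2
  (fun x Ax => (iB x Ax).2) (fun y By => (iA y By).2) B2 iM.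
by split; [split|apply: eq_complexRI].
Qed.

End ComplexFubini.

(** * Nonvanishing of the Gamma integral *)

Section GammaNonvanishing.
Context {R : realType}.
Notation mu := (@lebesgue_measure R).
Local Notation posR := (`]0%R, +oo[%classic : set R).
Implicit Types (s t : R) (z w : R[i]).

Definition rgamma s : R := \int[mu]_(t in posR) (t `^ (s - 1) * expR (- t)).

Lemma Gamma_integral_real s : 0 < s -> Gamma_integral s%:C = (rgamma s)%:C.
Proof.
move=> s0; have E t : t \in posR ->
    cpow t (s%:C - 1) * (expR (- t))%:C = (t `^ (s - 1) * expR (- t))%:C.
  rewrite inE in_posR => t0.
  have -> : s%:C - 1 = (s - 1)%:C by rewrite rmorphB.
  by rewrite cpow_real// rmorphM.
rewrite /Gamma_integral (eq_cintegral _ _ _ E) /cintegral /=.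
by congr Complex; rewrite /Rintegral integral0.
Qed.

Lemma rgamma_rec s : 0 < s -> rgamma (s + 1) = s * rgamma s.
Proof.
move=> s0; have := Gamma_integral_rec s%:C; rewrite (_ : s%:C + 1 = (s + 1)%:C).
  by rewrite !Gamma_integral_real ?addr_gt0// -rmorphM => /(_ s0)[].
by rewrite rmorphD.
Qed.

(** On [`[1, 2]] the integrand is at least [expR (- 2)]. *)
Lemma rgamma_gt0 s : 1 <= s -> 0 < rgamma s.
Proof.
move=> s1; have ig := integrable_gamma_real s (lt_le_trans ltr01 s1).
have mP := @measurable_posR R.
apply: (@lt_le_trans _ _ (expR (- 2))); first exact: expR_gt0.
rewrite -lee_fin /rgamma /Rintegral fineK; last exact: integrable_fin_num.
apply: (@le_trans _ _ (\int[mu]_(t in `[1%R, 2%R]) (t `^ (s - 1) * expR (- t))%:E)%E).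
  apply: (@le_trans _ _ (\int[mu]_(t in `[1%R, 2%R]) (cst (expR (- 2))%:E t))%E).
    rewrite integral_cst//= lebesgue_measure_itv/= lte_fin ltr1n//=.
    by rewrite -EFinB -EFinM (_ : 2 - 1 = 1) ?mulr1//; lra.
  apply: ge0_le_integral => //.
  - by move=> t _; rewrite lee_fin expR_ge0.
  - apply: measurable_funS (measurable_int mu ig) => // t /=.
    by rewrite !in_itv/= andbT => /andP[+ _]; exact: lt_le_trans.
  - move=> t; rewrite /= in_itv/= => /andP[t1 t2]; rewrite lee_fin.
    rewrite -[leLHS]mul1r ler_pM ?expR_ge0// ?ler_expR ?lerN2//.
    by rewrite -[leLHS](powRr0 t) ler_powR// subr_ge0.
apply: ge0_subset_integral => //.
- exact: (measurable_int mu ig).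
- by move=> t _; rewrite lee_fin mulr_ge0 ?powR_ge0 ?expR_ge0.
- by move=> t /=; rewrite !in_itv/= andbT => /andP[+ _]; exact: lt_le_trans.
Qed.

Lemma ler_norm_sin (y : R) : `|sin y| <= `|y|.
Proof.
wlog y0 : y / 0 < y.
  move=> H; have [y0|y0|->] := ltgtP y 0; last by rewrite sin0.
    by rewrite -normrN -sinN -[leRHS]normrN H// oppr_gt0.
  exact: H.
have [|c _] := MVT y0 (fun x _ => is_derive_sin x).
  by apply: continuous_subspaceT => x; exact: continuous_sin.
rewrite sin0 !subr0 => ->; rewrite normrM ler_piMl//; exact: cos_max.
Qed.

(** From [1 - cos y = 2 * sin (y / 2) ^+ 2] and [`|sin x| <= `|x|]. *)
Lemma cos_ge_quadratic (y : R) : 1 - y ^+ 2 / 2 <= cos y.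
Proof.
have -> : y = (y / 2) *+ 2 by rewrite mulr2n -splitr.
rewrite cos_mulr2n cos2sin2; set x := y / 2.
have : sin x ^+ 2 <= x ^+ 2.
  by rewrite -[leLHS]real_normK ?num_real// -[leRHS]real_normK ?num_real// lerXn2r
    ?nnegrE// ler_norm_sin.
rewrite (_ : (x *+ 2) ^+ 2 / 2 = 2 * x ^+ 2); last by rewrite mulr2n; field.
by rewrite !mulr2n; move: (sin x ^+ 2) (x ^+ 2) => p q; lra.
Qed.

(** For [u = r ^+ 2] with [1 <= r] this is the square of
    [ln u = 2 * ln r <= 2 * (r - r^-1)]; both sides are invariant under [u -> u^-1].
    The right-hand side is chosen for its moments: against the Gamma density the
    functions [u] and [u^-1] integrate to values of [rgamma] at neighbouring
    arguments. *)
Lemma ln_sqr_le (u : R) : 0 < u -> ln u ^+ 2 <= 4 * (u - 2 + u^-1).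
Proof.
have main (v : R) : 1 <= v -> ln v ^+ 2 <= 4 * (v - 2 + v^-1).
  move=> v1; have v0 : 0 < v by apply: lt_le_trans v1.
  set r := Num.sqrt v.
  have r1 : 1 <= r by rewrite -[leLHS]sqrtr1 ler_wsqrtr.
  have r0 : 0 < r by apply: lt_le_trans r1.
  have -> : v = r ^+ 2 by rewrite sqr_sqrtr// ltW.
  rewrite lnXn//.
  have l0 : 0 <= ln r by rewrite ln_ge0.
  have l1 : ln r <= r - r^-1.
    apply: (@le_trans _ _ (r - 1)); last by rewrite lerB// invf_le1.
    by have := @le_ln1Dx R (r - 1); rewrite subrKC; apply; lra.
  have -> : r ^+ 2 - 2 + (r ^+ 2)^-1 = (r - r^-1) ^+ 2 by field; rewrite gt_eqF.
  have -> : (ln r *+ 2) ^+ 2 = 4 * ln r ^+ 2 by rewrite mulr2n; ring.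
  by rewrite ler_pM2l// lerXn2r ?nnegrE//; apply: le_trans l1.
move=> u0; have [u1|u1] := leP 1 u; first exact: main.
have := main u^-1; rewrite invf_ge1// (ltW u1) lnV// sqrrN invrK => /(_ isT).
by rewrite -addrA [- 2 + u]addrC addrA [u^-1 + u]addrC addrAC.
Qed.

(** Rotate by [cpow N (- i tau)], so that the oscillating factor becomes
    [cos (tau * ln (t / N))]. Bounding it below by
    [1 - 2 * tau ^+ 2 * (t / N - 2 + N / t)] and integrating gives
    [rgamma N * (1 - 2 * tau ^+ 2 / (N - 1))], which is positive. *)
Lemma Gamma_integral_neq0_far w : 2 * Ipart w ^+ 2 + 2 < Rpart w ->
  Gamma_integral w != 0.
Proof.
set N := Rpart w; set tau := Ipart w => Nbig.
have tau2 : 0 <= tau ^+ 2 by exact: sqr_ge0.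
have N2 : 2 < N by lra.
have N0 : 0 < N by lra.
have N1 : 0 < N - 1 by lra.
have mP := @measurable_posR R.
pose g s t := t `^ (s - 1) * expR (- t).
have ig s : 0 < s -> mu.-integrable posR (EFin \o g s) by exact: integrable_gamma_real.
pose A := 1 + 4 * tau ^+ 2; pose B := 2 * tau ^+ 2 / N; pose C := 2 * tau ^+ 2 * N.
have iZ s (r : R) : 0 < s -> mu.-integrable posR (EFin \o (fun t => r * g s t)).
  move=> s0; suff : mu.-integrable posR (fun t : R => r%:E * (g s t)%:E)%E by [].
  by apply: integrableZl => //; exact: ig.
pose rot := cpow N (0 +i* (- tau)).
have iw := cintegrable_gamma w N0.
have E : rot * Gamma_integral w = cintegral posR
    (fun t => rot * (cpow t (w - 1) * (expR (- t))%:C)) by rewrite cintegralZ.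
have [iRe _] := cintegrableZ posR rot _ mP iw.
apply/eqP => w0; suff : 0 < Rpart (rot * Gamma_integral w).
  by rewrite w0 mulr0 ltxx.
rewrite E.
have low t : posR t -> A * g N t - B * g (N + 1) t - C * g (N - 1) t <=
    Rpart (rot * (cpow t (w - 1) * (expR (- t))%:C)).
  rewrite in_posR => t0.
  have -> : Rpart (rot * (cpow t (w - 1) * (expR (- t))%:C)) =
      g N t * cos (tau * ln (t / N)).
    rewrite mulrA RpartMr /rot /cpow -cexpD /cexp RpartM /= mul0r subr0.
    rewrite RpartD IpartD !RpartM !IpartM /= RpartB1.
    rewrite (_ : Ipart (w - 1) = tau); last by rewrite IpartD IpartN /= subr0.
    rewrite ln_div ?posrE// /g /powR gt_eqF// -/N.
    rewrite !(mul0r, mulr0, addr0, add0r, subr0, oppr0).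
    by rewrite mulrAC; congr (_ * _ * cos _); ring.
  have u0 : 0 < t / N by rewrite divr_gt0.
  have g0 : 0 <= g N t by rewrite mulr_ge0 ?powR_ge0 ?expR_ge0.
  have gS : g (N + 1) t = t * g N t.
    by rewrite /g addrK mulrA mulr_powRB1 // ltW.
  have gP : g (N - 1) t = t^-1 * g N t.
    by rewrite /g powRB ?(gt_eqF t0) ?implybT// powRr1 ?ltW//; ring.
  rewrite gS gP.
  have -> : A * g N t - B * (t * g N t) - C * (t^-1 * g N t) =
      g N t * (1 - 2 * tau ^+ 2 * (t / N - 2 + (t / N)^-1)).
    by rewrite /A /B /C; field; rewrite !gt_eqF.
  rewrite ler_wpM2l//; apply: le_trans (cos_ge_quadratic _); rewrite lerB//.
  have := ln_sqr_le _ u0; rewrite exprMn => L.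
  by rewrite ler_pdivrMr//; move: L tau2; nra.
have iL : mu.-integrable posR
    (EFin \o (fun t => A * g N t - B * g (N + 1) t - C * g (N - 1) t)).
  suff : mu.-integrable posR (fun t : R =>
      (A * g N t)%:E - (B * g (N + 1) t)%:E - (C * g (N - 1) t)%:E)%E by [].
  apply: integrableB => //; last exact: iZ.
  by apply: integrableB => //; apply: iZ; rewrite // addr_gt0.
suff : 0 < \int[mu]_(t in posR) (A * g N t - B * g (N + 1) t - C * g (N - 1) t).
  move=> /lt_le_trans; apply; apply: le_Rintegral => //; exact: iL.
have -> : \int[mu]_(t in posR) (A * g N t - B * g (N + 1) t - C * g (N - 1) t) =
    A * rgamma N - B * rgamma (N + 1) - C * rgamma (N - 1).
  rewrite RintegralB//; last 2 first.
  - suff : mu.-integrable posR (fun t : R =>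
      (A * g N t)%:E - (B * g (N + 1) t)%:E)%E by [].
    by apply: integrableB => //; apply: iZ; rewrite // addr_gt0.
  - exact: iZ.
  rewrite RintegralB//; [|exact: iZ|by apply: iZ; rewrite addr_gt0].
  by rewrite !RintegralZl//; apply: ig; rewrite // addr_gt0.
have := rgamma_rec (N - 1) N1; rewrite subrK => r1.
rewrite rgamma_rec//.
have -> : rgamma (N - 1) = rgamma N / (N - 1).
  by rewrite r1; field; rewrite gt_eqF.
have -> : A * rgamma N - B * (N * rgamma N) - C * (rgamma N / (N - 1)) =
    rgamma N * ((N - 1 - 2 * tau ^+ 2) / (N - 1)).
  by rewrite /A /B /C; field; rewrite !gt_eqF.
apply: mulr_gt0; first by apply: rgamma_gt0; lra.
by apply: divr_gt0 => //; lra.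
Qed.

Lemma pochhammerS (a : R[i]) n : pochhammer a n.+1 = pochhammer a n * (a + n%:R).
Proof. by rewrite /pochhammer big_ord_recr. Qed.

Lemma Gamma_integral_addn z n : 0 < Rpart z ->
  Gamma_integral (z + n%:R) = pochhammer z n * Gamma_integral z.
Proof.
move=> z0; elim: n => [|n IH]; first by rewrite addr0 /pochhammer big_ord0 mul1r.
rewrite -natr1 addrA Gamma_integral_rec ?IH ?pochhammerS; last first.
  by rewrite RpartD Rpart_nat ltr_wpDr.
by rewrite mulrA [_ * pochhammer z n]mulrC.
Qed.

(** A zero at [z] would propagate to all [z + n] by the functional equation. *)
Lemma Gamma_integral_neq0 z : 0 < Rpart z -> Gamma_integral z != 0.
Proof.
move=> z0; pose n := (Num.truncn (2 * Ipart z ^+ 2 + 2)).+1.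
have : Gamma_integral (z + n%:R) != 0.
  apply: Gamma_integral_neq0_far; rewrite RpartD IpartD Rpart_nat Ipart_nat addr0.
  by apply: lt_le_trans (truncnS_gt _) _; rewrite lerDr ltW.
by apply: contra => /eqP e; rewrite Gamma_integral_addn// e mulr0.
Qed.

End GammaNonvanishing.

(** * Beta integrals *)

Section Beta.
Local Opaque cpow Gamma_integral rgamma.
Context {R : realType}.
Notation mu := (@lebesgue_measure R).
Local Notation posR := (`]0%R, +oo[%classic : set R).
Implicit Types (s t : R) (z w a b : R[i]).

Lemma real_complex_neq0 (r : R) : r != 0 -> r%:C != 0.
Proof. by apply: contra => /eqP[->]. Qed.

Lemma integral_rgamma_scale s t : 0 < s -> 0 < t ->
  (\int[mu]_(r in posR) (r `^ (s - 1) * expR (- (t * r)))%:E =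
   (t `^ (- s) * rgamma s)%:E)%E.
Proof.
move=> s0 t0; have mP := @measurable_posR R.
have [[iR _] E] := gamma_scale s%:C t s0 t0.
have rE r : posR r -> Rpart (cpow r (s%:C - 1) * (expR (- (t * r)))%:C) =
    r `^ (s - 1) * expR (- (t * r)).
  rewrite in_posR => r0; have -> : s%:C - 1 = (s - 1)%:C by rewrite rmorphB.
  by rewrite cpow_real// -rmorphM.
have iR' : mu.-integrable posR (fun r : R => (r `^ (s - 1) * expR (- (t * r)))%:E).
  by apply: eq_integrable iR => // r; rewrite inE => /rE ->.
transitivity (Rpart (cintegral posR
    (fun r => cpow r (s%:C - 1) * (expR (- (t * r)))%:C)))%:E.
  have -> : Rpart (cintegral posR
      (fun r => cpow r (s%:C - 1) * (expR (- (t * r)))%:C)) =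
      \int[mu]_(r in posR) (r `^ (s - 1) * expR (- (t * r))).
    by apply: eq_Rintegral => r; rewrite inE => /rE.
  by rewrite /Rintegral fineK//; exact: integrable_fin_num.
rewrite E Gamma_integral_real// RpartMr.
have -> : - s%:C = (- s)%:C by rewrite rmorphN.
by rewrite cpow_real.
Qed.

(** Euler's second Beta integral. In [Gamma b] the substitution [u := t * r], for the
    variable [t] of [Gamma a], gives the double integral of
    [r^(b-1) t^(a+b-1) e^(-(1+r)t)]; integrating over [t] first leaves
    [Gamma (a + b)] times the integral over [r]. *)
Lemma Gamma_integral_mul a b : 0 < Rpart a -> 0 < Rpart b ->
  cintegrable posR (fun r => cpow r (b - 1) * cpow (1 + r) (- (a + b))) /\
  Gamma_integral a * Gamma_integral b = Gamma_integral (a + b) *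
    cintegral posR (fun r => cpow r (b - 1) * cpow (1 + r) (- (a + b))).
Proof.
move=> a0 b0; have mP := @measurable_posR R.
have ab0 : 0 < Rpart (a + b) by rewrite RpartD addr_gt0.
have nz := Gamma_integral_neq0 (a + b) ab0.
pose F (r t : R) := cpow r (b - 1) *
  (cpow t (a + b - 1) * (expR (- ((1 + r) * t)))%:C).
have FE r t : F r t = cpow t (a + b - 1) * (expR (- t))%:C *
    (cpow r (b - 1) * (expR (- (t * r)))%:C).
  rewrite /F mulrDl mul1r opprD expRD rmorphM [r * t]mulrC; ring.
have mF : cmeasurable setT (fun p : R * R => F p.1 p.2).
  apply: cmeasurableM; first exact: cmeasurable_cpow.
  apply: cmeasurableM; first exact: cmeasurable_cpow.
  apply: cmeasurable_real; apply: measurableT_comp => //.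
  apply: measurableT_comp => //; apply: measurable_funM => //.
  exact: measurable_funD.
have it r : posR r -> cintegrable posR (F r).
  rewrite in_posR => r0; apply: cintegrableZ => //.
  by have [] := gamma_scale (a + b) (1 + r) ab0 (addr_gt0 ltr01 r0).
have ir t : posR t -> cintegrable posR (fun r => F r t).
  rewrite in_posR => t0; have [i _] := gamma_scale b t b0 t0.
  apply: (eq_cintegrable posR _ _ mP) (cintegrableZ posR
    (cpow t (a + b - 1) * (expR (- t))%:C) _ mP i) => r _.
  by rewrite FE.
pose M t := rgamma (Rpart b) * (t `^ (Rpart a - 1) * expR (- t)).
have FM t : posR t -> (\int[mu]_(r in posR) (normc (F r t))%:E <= (M t)%:E)%E.
  rewrite in_posR => t0.
  have -> : (\int[mu]_(r in posR) (normc (F r t))%:E = \int[mu]_(r in posR)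
      ((t `^ (Rpart (a + b) - 1) * expR (- t))%:E *
       (r `^ (Rpart b - 1) * expR (- (t * r)))%:E))%E.
    apply: eq_integral => r; rewrite inE in_posR => r0.
    by rewrite FE normcM !normc_cpow_expR// EFinM.
  rewrite ge0_integralZl//; last 3 first.
  - apply/measurable_EFinP; apply: measurable_funM; apply: measurable_funTS.
      exact: measurable_powR.
    apply: measurableT_comp => //; apply: measurableT_comp => //.
  - by move=> r _; rewrite lee_fin mulr_ge0 ?powR_ge0 ?expR_ge0.
  - by rewrite lee_fin mulr_ge0 ?powR_ge0 ?expR_ge0.
  rewrite integral_rgamma_scale// -EFinM lee_fin le_eqVlt; apply/orP; left; apply/eqP.
  rewrite /M RpartD.
  have -> : t `^ (Rpart a + Rpart b - 1) = t `^ (Rpart a - 1) * t `^ (Rpart b).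
    by rewrite -powRD ?(gt_eqF t0) ?implybT//; congr powR; ring.
  rewrite powRN; field; rewrite gt_eqF// powR_gt0//.
have iM : mu.-integrable posR (fun t : R => (M t)%:E).
  suff : mu.-integrable posR (fun t : R =>
    (rgamma (Rpart b))%:E * (t `^ (Rpart a - 1) * expR (- t))%:E)%E by [].
  by apply: integrableZl => //; exact: integrable_gamma_real.
have [I E] := cintegral_Fubini posR posR F M mP mP mF it ir FM iM.
have inner_t r : posR r -> cintegral posR (F r) =
    Gamma_integral (a + b) * (cpow r (b - 1) * cpow (1 + r) (- (a + b))).
  rewrite in_posR => r0.
  have [i e] := gamma_scale (a + b) (1 + r) ab0 (addr_gt0 ltr01 r0).
  by rewrite (cintegralZ posR (cpow r (b - 1)) _ mP i) e mulrA mulrC.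
have inner_r t : posR t -> cintegral posR (fun r => F r t) =
    Gamma_integral b * (cpow t (a - 1) * (expR (- t))%:C).
  rewrite in_posR => t0; have [i e] := gamma_scale b t b0 t0.
  under eq_cintegral do rewrite FE.
  rewrite (cintegralZ posR (cpow t (a + b - 1) * (expR (- t))%:C) _ mP i) e.
  have -> : cpow t (a - 1) = cpow t (a + b - 1) * cpow t (- b).
    by rewrite -cpowD; congr cpow; ring.
  move: (Gamma_integral b) (cpow t (- b)) (cpow t (a + b - 1)) (expR (- t))%:C => *.
  by ring.
have I' : cintegrable posR (fun r => cpow r (b - 1) * cpow (1 + r) (- (a + b))).
  apply: (eq_cintegrable posR _ _ mP) (cintegrableZ posR
    (Gamma_integral (a + b))^-1 _ mP I) => r; rewrite inE => rP.
  by rewrite (inner_t _ rP) mulrA (mulVf nz) mul1r.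
split; first exact: I'.
rewrite -(cintegralZ _ _ _ mP I').
transitivity (cintegral posR (fun t => cintegral posR (fun r => F r t))).
  rewrite mulrC -(cintegralZ _ _ _ mP (cintegrable_gamma _ a0)).
  by apply: eq_cintegral => t; rewrite inE => tP; rewrite (inner_r _ tP).
rewrite -E; apply: eq_cintegral => r; rewrite inE => rP.
exact: inner_t.
Qed.

(** The substitution [r := t / (x - t)] in [Gamma_integral_mul]. *)
Lemma beta_integral a b (x : R) : 0 < Rpart a -> 0 < Rpart b -> 0 < x ->
  cintegrable `]0, x[%classic (fun t => cpow (x - t) (a - 1) * cpow t (b - 1)) /\
  cintegral `]0, x[%classic (fun t => cpow (x - t) (a - 1) * cpow t (b - 1)) =
  cpow x (a + b - 1) *
    (Gamma_integral a * Gamma_integral b / Gamma_integral (a + b)).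
Proof.
move=> a0 b0 x0; have [I E] := Gamma_integral_mul a b a0 b0.
have ab0 : 0 < Rpart (a + b) by rewrite RpartD addr_gt0.
have nz := Gamma_integral_neq0 (a + b) ab0.
pose f r := cpow r (b - 1) * cpow (1 + r) (- (a + b)).
have cf y : 0 < y -> ccontinuous_at f y.
  move=> y0; apply: ccontinuousM; apply: (ccontinuous_cpow (fun r => _)) => //.
  - by apply: continuousD; [exact: cst_continuous|exact: cvg_id].
  - by rewrite addr_gt0.
have eI := exhaustible_oo x x0; have P := param_moebius x x0.
have [iP _] := cintegrable_param _ _ _ f eI P cf; have {}iP := iP I.
have EP := cintegral_param _ _ _ f eI P cf.
have mI : measurable (`]0, x[%classic : set R) by exact: measurable_itv.
have fE : {in (`]0, x[%classic : set R),
    (fun t => cpow (x - t) (a - 1) * cpow t (b - 1)) =1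
    (fun t => cpow x (a + b - 1) * (f (t / (x - t)) * (x / (x - t) ^+ 2)%:C))}.
  move=> t; rewrite inE /= in_itv/= => /andP[t0 tx].
  have y0 : 0 < x - t by rewrite subr_gt0.
  have -> : f (t / (x - t)) = cpow (t / (x - t)) (b - 1) * cpow (x / (x - t)) (- (a + b)).
    by rewrite /f (_ : 1 + t / (x - t) = x / (x - t)); last by field; rewrite gt_eqF.
  rewrite !cpowM ?invr_gt0// !cpowV//.
  rewrite rmorphM fmorphV rmorphXn /=.
  rewrite !(cpowN, cpowD) !cpow1//.
  have := real_complex_neq0 _ (lt0r_neq0 x0).
  have := real_complex_neq0 _ (lt0r_neq0 y0).
  have := real_complex_neq0 _ (lt0r_neq0 t0).
  move: (cpow_neq0 x a) (cpow_neq0 x b) (cpow_neq0 (x - t) a) (cpow_neq0 (x - t) b).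
  move: (cpow x a) (cpow x b) (cpow (x - t) a) (cpow (x - t) b) (cpow t b).
  move: (x%:C) ((x - t)%:C) (t%:C) => X Y T p1 p2 p3 p4 p5 n1 n2 n3 n4 n5 n6 n7.
  by field; rewrite n1 n2 n3 n4 n5 n6 n7.
split.
  apply: (eq_cintegrable _ _ _ mI) (cintegrableZ _ (cpow x (a + b - 1)) _ mI iP) => t tI.
  by rewrite fE.
rewrite (eq_cintegral _ _ _ fE) (cintegralZ _ _ _ mI iP) -EP E -/f.
by rewrite (mulrC (Gamma_integral _)) (mulfK nz).
Qed.

End Beta.

(** * Pochhammer symbols and the continuation of Gamma *)

Section GammaOffPoles.
Context {R : realType}.
Local Notation posR := (`]0%R, +oo[%classic : set R).
Local Opaque cpow Gamma_integral.
Implicit Types (z a b : R[i]) (n m : nat).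

Lemma not_nonpos_integer_gt0 z : 0 < Rpart z -> ~ nonpos_integer z.
Proof. by move=> z0 [n zE]; move: z0; rewrite zE RpartN Rpart_nat oppr_gt0 ltrn0. Qed.

Lemma not_nonpos_integerD z n : ~ nonpos_integer z -> ~ nonpos_integer (z + n%:R).
Proof.
move=> nz [m zE]; apply: nz; exists (m + n)%N.
by rewrite natrD opprD -zE addrK.
Qed.

Lemma pochhammer0 a : pochhammer a 0 = 1.
Proof. by rewrite /pochhammer big_ord0. Qed.

Lemma pochhammer_neq0 a n : ~ nonpos_integer a -> pochhammer a n != 0.
Proof.
move=> na; apply/prodf_neq0 => i _; apply/negP => /eqP e; apply: na.
by exists i; apply/eqP; rewrite -addr_eq0 e.
Qed.

Lemma pochhammerD a m n :
  pochhammer a (m + n) = pochhammer a m * pochhammer (a + m%:R) n.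
Proof.
elim: n => [|n IH]; first by rewrite addn0 pochhammer0 mulr1.
by rewrite addnS !pochhammerS IH mulrA natrD addrA.
Qed.

(** This duplication is where the halved parameters of the hypergeometric series
    come from. *)
Lemma pochhammer_double a n : pochhammer a (2 * n) =
  4 ^+ n * (pochhammer (a / 2) n * pochhammer ((a + 1) / 2) n).
Proof.
elim: n => [|n IH]; first by rewrite muln0 !pochhammer0 expr0 !mulr1.
rewrite (_ : (2 * n.+1 = (2 * n).+2)%N); last by rewrite mulnS.
rewrite !pochhammerS IH exprS -[(2 * n).+1%:R]natr1 natrM.
by move: (pochhammer _ _) (pochhammer _ _) (4 ^+ n) => p q r; field.
Qed.

(** Every admissible shift computes the same value, by the functional equation, and
    not only the least one used in the definition. *)
Lemma Gamma_shift z m : ~ nonpos_integer z -> 0 < Rpart (z + m%:R) ->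
  Gamma z = Gamma_integral (z + m%:R) / pochhammer z m.
Proof.
move=> nz.
have up m' j : 0 < Rpart (z + m'%:R) ->
    Gamma_integral (z + (m' + j)%:R) / pochhammer z (m' + j) =
    Gamma_integral (z + m'%:R) / pochhammer z m'.
  move=> m0; rewrite natrD addrA (Gamma_integral_addn _ _ m0) pochhammerD.
  have := pochhammer_neq0 (z + m'%:R) j (not_nonpos_integerD _ _ nz).
  have := pochhammer_neq0 z m' nz.
  move: (pochhammer _ _) (pochhammer _ _) (Gamma_integral _) => p q r p0 q0.
  by field; rewrite p0 q0.
have key m1 m2 : 0 < Rpart (z + m1%:R) -> 0 < Rpart (z + m2%:R) ->
    Gamma_integral (z + m1%:R) / pochhammer z m1 =
    Gamma_integral (z + m2%:R) / pochhammer z m2.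
  move=> h1 h2; have [le12|/ltnW le21] := leqP m1 m2.
    by rewrite -(subnKC le12) up.
  by rewrite -(subnKC le21) up.
move=> m0; rewrite /Gamma; case: ifPn => [z0|].
  by rewrite -(key 0%N m) ?addr0 // pochhammer0 divr1.
rewrite -leNgt => z0; apply: (key _ m) m0.
rewrite RpartD Rpart_nat -ltrBlDl sub0r; exact: truncnS_gt.
Qed.

Lemma Gamma_gt0E z : 0 < Rpart z -> Gamma z = Gamma_integral z.
Proof. by move=> z0; rewrite /Gamma z0. Qed.

Lemma shift_gt0 z : exists m : nat, forall n, 0 < Rpart (z + (n + m)%:R).
Proof.
exists (Num.truncn (- Rpart z)).+1 => n; rewrite RpartD Rpart_nat natrD.
rewrite addrCA ltr_wpDl ?ler0n// -ltrBlDl sub0r; exact: truncnS_gt.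
Qed.

Lemma Gamma_addn z n : ~ nonpos_integer z ->
  Gamma (z + n%:R) = pochhammer z n * Gamma z.
Proof.
move=> nz; have [m m0] := shift_gt0 z.
rewrite (Gamma_shift z _ nz (m0 n)) (Gamma_shift (z + n%:R) m); last first.
- by rewrite -addrA -natrD.
- exact: not_nonpos_integerD.
rewrite pochhammerD natrD addrA.
have := pochhammer_neq0 (z + n%:R) m (not_nonpos_integerD _ _ nz).
have := pochhammer_neq0 z n nz.
move: (pochhammer _ _) (pochhammer _ _) (Gamma_integral _) => p q r p0 q0.
by field; rewrite p0 q0.
Qed.

Lemma Gamma_neq0 z : ~ nonpos_integer z -> Gamma z != 0.
Proof.
move=> nz; have [m m0] := shift_gt0 z.
rewrite (Gamma_shift z _ nz (m0 0%N)) mulf_neq0 ?invr_neq0//.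
  exact: Gamma_integral_neq0.
exact: pochhammer_neq0.
Qed.

(** For [Rpart z > 0], the substitution [u := t `^ k / k]; otherwise by definition. *)
Lemma GammakE (k : R) z : 0 < k ->
  Gammak k z = cpow k (z / k%:C - 1) * Gamma (z / k%:C).
Proof.
move=> k0; rewrite /Gammak; case: ifPn => // z0.
have kC : k%:C != 0 := real_complex_neq0 _ (lt0r_neq0 k0).
have ReV : 0 < Rpart (z / k%:C).
  by rewrite -fmorphV RpartMr divr_gt0.
have P := param_power k k0; have eI := @exhaustible_posR R.
have mP := @measurable_posR R.
have cg := ccontinuous_gamma1 (z / k%:C).
have [i _] := cintegrable_param _ _ _ _ eI P cg.
have {}i := i (cintegrable_gamma _ ReV).
rewrite (Gamma_gt0E _ ReV).
rewrite -[Gamma_integral _]/(cintegral posR _) (cintegral_param _ _ _ _ eI P cg).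
rewrite -(cintegralZ _ _ _ mP i); apply: eq_cintegral => t.
rewrite inE in_posR => t0; set s := z / k%:C - 1.
have -> : cpow (t `^ k / k) s = cpow t (z - k%:C) / cpow k s.
  rewrite cpowM ?powR_gt0 ?invr_gt0// cpowV// cpow_powR//.
  by congr (cpow _ _ / _); rewrite /s; field.
have -> : (t `^ (k - 1))%:C = cpow t (k%:C - 1).
  by rewrite -cpow_real// rmorphB.
have -> : cpow t (z - 1) = cpow t (z - k%:C) * cpow t (k%:C - 1).
  by rewrite -cpowD; congr cpow; ring.
move: (cpow_neq0 k s).
move: (cpow k s) (cpow t (z - k%:C)) (cpow t (k%:C - 1)) => p q r p0.
by move: ((expR _)%:C) => e; field.
Qed.

End GammaOffPoles.

(** * The k-Bessel series *)

Section BesselSeries.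
Context {R : realType}.
Notation mu := (@lebesgue_measure R).
Local Opaque cpow Gamma_integral Gamma Gammak.
Implicit Types (z a b v : R[i]) (n m : nat) (k c t x : R).

(** From some index on all factors [b + i] have modulus at least [1]. *)
Lemma pochhammer_inv_bounded b : ~ nonpos_integer b ->
  exists2 M : R, 0 <= M & forall n, normc (pochhammer b n)^-1 <= M.
Proof.
move=> nb; pose N := (Num.truncn (1 - Rpart b)).+1.
have far i : (N <= i)%N -> 1 <= normc (b + i%:R).
  move=> Ni; apply: le_trans (le_trans (ler_norm _) (Rpart_le_normc _)).
  rewrite RpartD Rpart_nat -lerBlDl; apply: (le_trans (ltW (truncnS_gt _))).
  by rewrite ler_nat.
pose M := \sum_(i < N.+1) normc (pochhammer b i)^-1.
exists M; first by apply: sumr_ge0 => i _; exact: normc_ge0.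
have small n : (n <= N)%N -> normc (pochhammer b n)^-1 <= M.
  move=> nN; rewrite /M (bigD1 (inord n))//= inordK ?ltnS// lerDl.
  by apply: sumr_ge0 => i _; exact: normc_ge0.
move=> n; have [/small//|/ltnW nN] := leqP n N.
rewrite -(subnKC nN); elim: (n - N)%N => [|j IH]; first by rewrite addn0 small.
rewrite addnS pochhammerS invfM normcM; apply: le_trans IH.
rewrite ler_piMr ?normc_ge0// normcV invf_le1 ?far ?leq_addr//.
by apply: lt_le_trans (far _ _); rewrite ?leq_addr.
Qed.

(** The k-Bessel function is [bessel_sum] times a constant and a power of [t], where
    [b = v / k + 1] and [y = - c / (4 k)]; see [kBesselE]. *)
Definition bessel_coef b (y : R) n : R[i] :=
  (y ^+ n)%:C / (pochhammer b n * (n`!)%:R).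

(** Since the inverse Pochhammer symbols are bounded, the exponential series
    dominates. *)
Lemma bessel_coef_bound b y : ~ nonpos_integer b -> exists2 d : nat -> R,
  (forall n, normc (bessel_coef b y n) <= d n) &
  forall t, cvgn (series (fun n => d n * t ^+ (2 * n))).
Proof.
move=> nb; have [M M0 HM] := pochhammer_inv_bounded b nb.
exists (fun n => M * (`|y| ^+ n / n`!%:R)) => [n|t].
  rewrite /bessel_coef invfM mulrCA normcM ler_pM ?normc_ge0//.
  rewrite normcM normc_real normrX normcV ler_wpM2l ?exprn_ge0//.
  by rewrite -(rmorph_nat (real_complex R)) normc_real ger0_norm.
rewrite (_ : (fun n => _) = M *: (exp_coeff (`|y| * t ^+ 2))).
  exact/is_cvg_seriesZ/is_cvg_series_exp_coeff.
apply/funext => n.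
rewrite -[RHS]/(M * ((`|y| * t ^+ 2) ^+ n / n`!%:R)) exprMn -exprM.
by move: (t ^+ _) (_ ^+ n) => p q; ring.
Qed.

Definition bessel_sum b y t : R[i] :=
  cseries_sum (fun n => bessel_coef b y n * (t ^+ (2 * n))%:C).

Lemma csummable_bessel b y t : ~ nonpos_integer b ->
  csummable (fun n => bessel_coef b y n * (t ^+ (2 * n))%:C).
Proof.
move=> nb; have [d db cd] := bessel_coef_bound b y nb.
apply: (csummable_le _ (fun n => d n * t ^+ (2 * n))) => // n.
have p0 : 0 <= t ^+ (2 * n) by rewrite exprM exprn_ge0 ?sqr_ge0.
by rewrite normcM normc_real (ger0_norm p0) ler_wpM2r.
Qed.

Lemma kBesselE k v c t : 0 < k -> 0 < t -> ~ nonpos_integer (v / k%:C + 1) ->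
  kBessel k v c t = (cpow (2 * k) (v / k%:C) * Gamma (v / k%:C + 1))^-1 *
    cpow t (v / k%:C) * bessel_sum (v / k%:C + 1) (- c / (4 * k)) t.
Proof.
move=> k0 t0 nb; set b := v / k%:C + 1.
have kC : k%:C != 0 := real_complex_neq0 _ (lt0r_neq0 k0).
rewrite /bessel_sum -(csummable_sumZ _ _ (csummable_bessel _ _ _ nb)) /kBessel.
congr cseries_sum; apply/funext => n.
rewrite (GammakE _ _ k0).
have -> : (n%:R * k%:C + v + k%:C) / k%:C = b + n%:R by rewrite /b; field.
rewrite (Gamma_addn _ _ nb).
have -> : cpow k (b + n%:R - 1) = cpow k (v / k%:C) * (k ^+ n)%:C.
  by rewrite -(cpow_nat _ _ k0) -cpowD; congr cpow; rewrite /b; ring.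
have -> : cpow (t / 2) ((2 * n)%:R + v / k%:C) =
    (t / 2)%:C ^+ (2 * n) * (cpow t (v / k%:C) / cpow 2 (v / k%:C)).
  have h0 : 0 < t / 2 by rewrite divr_gt0.
  by rewrite cpowD (cpow_nat _ _ h0) rmorphXn cpowM ?invr_gt0// cpowV.
rewrite cpowM// /bessel_coef.
rewrite !(rmorphXn, rmorphM, fmorphV, rmorphN) /= !exprMn !exprVn.
have -> : (2%:C : R[i]) ^+ (2 * n) = 4%:C ^+ n.
  by rewrite exprM -rmorphXn; congr (_%:C ^+ n); ring.
rewrite exprMn -/b.
move: (Gamma b) (pochhammer b n) (cpow k _) (cpow 2 _) (cpow t _) => G P p q r.
move: (_ ^+ n) (4%:C ^+ n) (k%:C ^+ n) (t%:C ^+ _) (n`!%:R) => X F K T N.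
by rewrite !invfM; ring.
Qed.

End BesselSeries.

(** * Termwise integration of the k-Bessel series *)

Section TermwiseIntegration.
Context {R : realType}.
Notation mu := (@lebesgue_measure R).
Local Opaque cpow Gamma_integral Gamma Gammak pochhammer.
Implicit Types (z a b m alpha : R[i]) (n : nat) (x y t : R).

(** The Erdélyi-Kober integrand without its constant factor; all powers of [t]
    outside the Bessel series are collected in [m]. *)
Definition bessel_kernel alpha m b y x t : R[i] :=
  cpow (x - t) (alpha - 1) * cpow t (m - 1) * bessel_sum b y t.

Lemma cintegral_bessel_kernel alpha m b y x :
  0 < Rpart alpha -> 0 < Rpart m -> 0 < x -> ~ nonpos_integer b ->
  cintegrable `]0, x[%classic (bessel_kernel alpha m b y x) /\
  cintegral `]0, x[%classic (bessel_kernel alpha m b y x) =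
  cpow x (alpha + m - 1) *
    (Gamma_integral alpha * Gamma_integral m / Gamma_integral (alpha + m)) *
  pFq [:: m / 2; (m + 1) / 2] [:: b; (alpha + m) / 2; (alpha + m + 1) / 2]
    (y * x ^+ 2)%:C.
Proof.
move=> a0 m0 x0 nb; have mI : measurable (`]0, x[%classic : set R) by exact: measurable_itv.
have am0 : 0 < Rpart (alpha + m) by rewrite RpartD addr_gt0.
pose w t := cpow (x - t) (alpha - 1) * cpow t (m - 1).
pose F n t := w t * (bessel_coef b y n * (t ^+ (2 * n))%:C).
have [iw _] := beta_integral alpha m x a0 m0 x0.
have [d db cd] := bessel_coef_bound b y nb.
have d0 n : 0 <= d n by apply: le_trans (normc_ge0 _) (db n).
have mw : cmeasurable `]0, x[%classic w by exact: cintegrable_measurable iw.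
have mF n : cmeasurable `]0, x[%classic (F n).
  apply: cmeasurableM mw _; apply: cmeasurableM; first exact: cmeasurable_cst.
  by apply: cmeasurable_real; exact: measurable_funX.
have c0 n : 0 <= d n * x ^+ (2 * n) by rewrite mulr_ge0 ?exprn_ge0 ?(ltW x0).
have Fb n t : `]0, x[%classic t ->
    normc (F n t) <= d n * x ^+ (2 * n) * normc (w t).
  rewrite /= in_itv/= => /andP[t0 tx].
  rewrite normcM mulrC ler_wpM2r ?normc_ge0// normcM normc_real.
  have tn0 : 0 <= t ^+ (2 * n) by rewrite exprn_ge0 ?(ltW t0).
  rewrite ger0_norm// ler_pM ?normc_ge0// lerXn2r ?nnegrE ?(ltW t0) ?(ltW tx)//.
  exact: ltW.
have [iS sI E] := cintegral_series _ F (fun n => d n * x ^+ (2 * n))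
  (fun t => normc (w t)) mI mF (cintegrable_normc _ _ mI iw) (cd x) c0
  (fun t _ => normc_ge0 _) Fb.
have gE : {in (`]0, x[%classic : set R),
    (fun t => cseries_sum (F ^~ t)) =1 bessel_kernel alpha m b y x}.
  by move=> t _; exact: (csummable_sumZ (w t) _ (csummable_bessel b y t nb)).
split; first exact: (eq_cintegrable _ _ _ mI gE iS).
rewrite -(eq_cintegral _ _ _ gE) -E.
set K := cpow x (alpha + m - 1) * _.
have K0 : K != 0.
  rewrite /K mulf_neq0 ?cpow_neq0// mulf_neq0 ?invr_neq0 ?mulf_neq0//;
    exact: Gamma_integral_neq0.
suff IE n : (\prod_(ai <- [:: m / 2; (m + 1) / 2]) pochhammer ai n) /
    (\prod_(bj <- [:: b; (alpha + m) / 2; (alpha + m + 1) / 2]) pochhammer bj n) *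
    ((y * x ^+ 2)%:C ^+ n / (n`!)%:R) = K^-1 * cintegral `]0, x[%classic (F n).
  have -> : pFq [:: m / 2; (m + 1) / 2]
      [:: b; (alpha + m) / 2; (alpha + m + 1) / 2] (y * x ^+ 2)%:C =
      cseries_sum (fun n => K^-1 * cintegral `]0, x[%classic (F n)).
    by congr cseries_sum; apply/funext => n; exact: IE.
  by rewrite (csummable_sumZ _ _ sI) mulrA (divff K0) mul1r.
have m2n : 0 < Rpart (m + (2 * n)%:R) by rewrite RpartD Rpart_nat ltr_wpDr.
have [ib Eb] := beta_integral alpha (m + (2 * n)%:R) x a0 m2n x0.
have FE : {in (`]0, x[%classic : set R), F n =1
    (fun t => bessel_coef b y n * (cpow (x - t) (alpha - 1) * cpow t (m + (2 * n)%:R - 1)))}.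
  move=> t; rewrite inE /= in_itv/= => /andP[t0 tx].
  rewrite /F /w (_ : m + (2 * n)%:R - 1 = m - 1 + (2 * n)%:R); last by ring.
  rewrite (cpowD t (m - 1)) (cpow_nat _ _ t0).
  move: (bessel_coef _ _ _) (cpow (x - t) _) (cpow t _) => p q r; ring.
rewrite (eq_cintegral _ _ _ FE) (cintegralZ _ _ _ mI ib) Eb.
rewrite addrA (Gamma_integral_addn _ _ m0) (Gamma_integral_addn _ _ am0).
rewrite !pochhammer_double.
have -> : cpow x (alpha + m + (2 * n)%:R - 1) =
    cpow x (alpha + m - 1) * (x ^+ 2)%:C ^+ n.
  have -> : (x ^+ 2)%:C ^+ n = cpow x (2 * n)%:R.
    by rewrite (cpow_nat _ _ x0) exprM [in RHS]rmorphXn.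
  by rewrite -cpowD; congr cpow; ring.
rewrite !big_cons !big_nil /K /bessel_coef.
have := Gamma_integral_neq0 alpha a0; have := Gamma_integral_neq0 m m0.
have := Gamma_integral_neq0 (alpha + m) am0; have := cpow_neq0 x (alpha + m - 1).
have : (4 : R[i]) ^+ n != 0 by rewrite expf_neq0// pnatr_eq0.
have -> : (y * x ^+ 2)%:C ^+ n = (y ^+ n)%:C * (x ^+ 2)%:C ^+ n.
  by rewrite rmorphM exprMn; congr (_ * _); rewrite [in RHS]rmorphXn.
(* The Pochhammer symbols and the factorial do not cancel: their inverses are
   kept as atoms, so that no nonvanishing is asked of them. *)
move: (Gamma_integral _) (Gamma_integral _) (Gamma_integral _) (cpow _ _) => G1 G2 G3 q.
rewrite !invfM invr1 !mulr1.
move: (4 ^+ n) ((y ^+ n)%:C) ((x ^+ 2)%:C ^+ n) (n`!%:R^-1) => F4 Y X N.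
move: (pochhammer _ _) (pochhammer _ _) => P1 P2.
move: (pochhammer _ _)^-1 (pochhammer _ _)^-1 (pochhammer _ _)^-1 => P3 P4 P5.
by move=> h1 h2 h3 h4 h5; field; rewrite h1 h2 h3 h4 h5.
Qed.

End TermwiseIntegration.

(** * Behaviour of the integrand at the origin *)

Section NonIntegrability.
Context {R : realType}.
Notation mu := (@lebesgue_measure R).
Local Opaque cpow Gamma_integral Gamma Gammak pochhammer.
Implicit Types (z a b m alpha : R[i]) (n : nat) (x y t : R).

(** The integral of [c / t] over [`[e, d]] is [c * (ln d - ln e)], which is unbounded
    as [e] tends to [0]. *)
Lemma not_integrable_inv (h : R -> R) (x d c : R) :
  0 < d -> d < x -> 0 < c ->
  mu.-integrable `]0, x[%classic (fun t => (h t)%:E) ->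
  (forall t, 0 <= h t) ->
  (forall t, 0 < t -> t <= d -> c / t <= h t) -> False.
Proof.
move=> d0 dx c0 ih h0 ch.
have mI : measurable (`]0, x[%classic : set R) by exact: measurable_itv.
set T := \int[mu]_(t in `]0, x[) h t.
(* With this [e] the integral of [c / t] over [`[e, d]] is [T + c]. *)
pose e := d * expR (- (T / c + 1)).
have T0 : 0 <= T by exact: Rintegral_ge0.
have e0 : 0 < e by rewrite mulr_gt0 ?expR_gt0.
have ed : e < d.
  rewrite /e gtr_pMr// expR_lt1 oppr_lt0.
  by apply: ltr_wpDl => //; rewrite divr_ge0 ?(ltW c0).
have cinv t : e <= t -> {for t, continuous (fun u : R => u^-1)}.
  by move=> et; apply: inv_continuous; rewrite gt_eqF// (lt_le_trans e0).
have cont : {within `[e, d], continuous (fun u : R => c / u)}.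
  apply: continuous_in_subspaceT => t; rewrite inE /= in_itv/= => /andP[et _].
  by apply: continuousM; [exact: cst_continuous|exact: cinv].
have FTC : (\int[mu]_(t in `[e, d]) (c / t)%:E = (c * ln d)%:E - (c * ln e)%:E)%E.
  have cl t : 0 < t -> {for t, continuous (fun u : R => c * ln u)}.
    by move=> t0; apply: continuousM; [exact: cst_continuous|exact: continuous_ln].
  have dl t : 0 < t -> is_derive t 1 (fun u : R => c * ln u) (c / t).
    move=> t0; have Dl : is_derive t 1 (fun u : R => ln u) t^-1 by exact: is_derive1_ln.
    exact: is_deriveZ.
  rewrite (continuous_FTC2 (F := fun u => c * ln u))//.
  - split.
    + move=> t; rewrite in_itv/= => /andP[et _].
      by have [] := dl t (lt_trans e0 et).
    + by apply: cvg_at_right_filter; exact: cl.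
    + by apply: cvg_at_left_filter; exact: cl.
  - move=> t; rewrite in_itv/= => /andP[et _].
    by rewrite derive1E; have [_ ->] := dl t (lt_trans e0 et).
have : (\int[mu]_(t in `[e, d]) (c / t)%:E <= T%:E)%E.
  rewrite /T /Rintegral fineK; last exact: integrable_fin_num.
  have sub : `[e, d] `<=` `]0, x[.
    move=> t /=; rewrite !in_itv/= => /andP[et td].
    by rewrite (lt_le_trans e0 et) (le_lt_trans td dx).
  apply: (@le_trans _ _ (\int[mu]_(t in `[e, d]) (h t)%:E)%E).
    apply: ge0_le_integral => //.
    - move=> t; rewrite /= in_itv/= => /andP[et _].
      by rewrite lee_fin divr_ge0 ?(ltW c0)// ltW// (lt_le_trans e0).
    - by apply/measurable_EFinP; exact: subspace_continuous_measurable_fun.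
    - by apply: measurable_funS (measurable_int mu ih).
    - move=> t; rewrite /= in_itv/= => /andP[et td].
      by rewrite lee_fin ch// (lt_le_trans e0).
  apply: ge0_subset_integral => //; first exact: (measurable_int mu ih).
  by move=> t _; rewrite lee_fin.
rewrite FTC -EFinB lee_fin.
rewrite /e lnM ?posrE ?expR_gt0// expRK.
have -> : c * ln d - c * (ln d - (T / c + 1)) = T + c by field; rewrite gt_eqF.
by rewrite gerDl leNgt c0.
Qed.

(** The sum tends to its constant coefficient [1] at the origin: for [t <= 1] the
    other terms add up to at most [t] times the sum of the bounds. *)
Lemma bessel_sum_near0 b y : ~ nonpos_integer b ->
  exists2 d : R, 0 < d & forall t, 0 < t -> t <= d -> 2^-1 <= normc (bessel_sum b y t).
Proof.
move=> nb; have [d db cd] := bessel_coef_bound b y nb.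
have d0 n : 0 <= d n by apply: le_trans (normc_ge0 _) (db n).
pose C := limn (series d).
have cd1 : cvgn (series d).
  by rewrite (_ : d = (fun n => d n * 1 ^+ (2 * n))) ?cd//;
    apply/funext => n; rewrite expr1n mulr1.
have dC n : series d n <= C.
  by apply: nondecreasing_cvgn_le => //; apply: nondecreasing_series => i _ _.
have C0 : 0 <= C by apply: le_trans (dC 0%N); rewrite /series /= big_geq.
(* [C + 1] rather than [C] keeps the bound positive and below [1]. *)
exists (2 * (C + 1))^-1; first by rewrite invr_gt0 mulr_gt0// ltr_wpDl.
move=> t t0 td.
have C1 : 0 < C + 1 by rewrite ltr_wpDl.
have tC : t * (2 * (C + 1)) <= 1.
  by rewrite -ler_pdivlMr ?mulr_gt0// div1r.
have t1 : t <= 1 by nra.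
apply: le_trans (Rpart_le_normc _); apply: le_trans (ler_norm _).
have [cv _] := csummable_bessel b y t nb.
apply: limr_ge => //; exists 1%N => // n /= n1.
rewrite -(prednK n1) /series /= big_nat_recl//=.
have -> : Rpart (bessel_coef b y 0 * (t ^+ (2 * 0))%:C) = 1.
  by rewrite /bessel_coef pochhammer0 fact0 muln0 !expr0 !rmorph1 !mulr1 invr1 mulr1.
have : - (t * C) <= \sum_(0 <= i < n.-1) Rpart (bessel_coef b y i.+1 * (t ^+ (2 * i.+1))%:C).
  apply: (@le_trans _ _ (- (t * \sum_(0 <= i < n.-1) d i.+1))).
    rewrite lerN2 ler_wpM2l ?(ltW t0)//; apply: le_trans (dC n).
    by rewrite /series /= -{2}(prednK n1) big_nat_recl//= lerDr.
  rewrite big_distrr /= -sumrN; apply: ler_sum => i _.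
  rewrite lerNl; apply: (le_trans (ler_norm _)); rewrite normrN.
  apply: (le_trans (Rpart_le_normc _)); rewrite normcM normc_real mulrC.
  rewrite ger0_norm ?exprn_ge0 ?(ltW t0)// ler_pM ?exprn_ge0 ?normc_ge0 ?(ltW t0)//.
  by rewrite mulnS exprS -[leRHS]mulr1 ler_wpM2l ?(ltW t0)// exprn_ile1 ?(ltW t0).
by nra.
Qed.

(** For [Rpart m <= 0] the factor [cpow t (m - 1)] has modulus at least a multiple
    of [t^-1] near [0], and the two other factors are bounded away from [0] there. *)
Lemma bessel_kernel_integrable_gt0 alpha m b y x : 0 < x ->
  ~ nonpos_integer b ->
  cintegrable `]0, x[%classic (bessel_kernel alpha m b y x) -> 0 < Rpart m.
Proof.
move=> x0 nb ik; rewrite ltNge; apply/negP => m0.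
have mI : measurable (`]0, x[%classic : set R) by exact: measurable_itv.
have [d0 d0_gt0 near0] := bessel_sum_near0 b y nb.
pose d := Num.min d0 (x / 2).
have d_gt0 : 0 < d by rewrite lt_min d0_gt0 divr_gt0.
have dx2 : d <= x / 2 by rewrite ge_min lexx orbT.
have dx : d < x by lra.
pose A := Rpart alpha - 1; pose L := `|ln (x / 2)| + `|ln x|.
pose c := expR (- (`|A| * L)) * expR (Rpart m * ln d) * 2^-1.
have c0 : 0 < c by rewrite !mulr_gt0 ?expR_gt0 ?invr_gt0.
apply: (not_integrable_inv (fun t => normc (bessel_kernel alpha m b y x t)) x d c) => //.
- exact: cintegrable_normc.
- by move=> t; exact: normc_ge0.
move=> t t0 td.
have xt2 : x / 2 <= x - t by lra.
have xt0 : 0 < x - t by lra.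
rewrite /bessel_kernel normcM (normcM (cpow _ _)) !normc_cpow !RpartB1 -/A.
have B1 : expR (- (`|A| * L)) <= expR (A * ln (x - t)).
  rewrite ler_expR lerNl; apply: (le_trans (ler_norm _)); rewrite normrN normrM.
  have l1 : ln (x / 2) <= ln (x - t) by rewrite ler_ln ?posrE ?divr_gt0.
  have l2 : ln (x - t) <= ln x by rewrite ler_ln ?posrE//; lra.
  have n1 := ler_norm (- ln (x / 2)); have n2 := ler_norm (ln x).
  rewrite normrN in n1.
  have p1 := normr_ge0 (ln (x / 2)); have p2 := normr_ge0 (ln x).
  by rewrite ler_wpM2l// ler_norml /L; apply/andP; split; lra.
have B2 : expR (Rpart m * ln d) / t <= expR ((Rpart m - 1) * ln t).
  rewrite mulrBl mul1r expRB lnK ?posrE// ler_wpM2r ?invr_ge0 ?(ltW t0)//.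
  by rewrite ler_expR ler_wnM2l// ler_ln ?posrE.
have B3 : 2^-1 <= normc (bessel_sum b y t).
  by apply: near0 => //; apply: le_trans td _; rewrite ge_min lexx.
rewrite (_ : c / t = expR (- (`|A| * L)) * (expR (Rpart m * ln d) / t) * 2^-1); last first.
  by rewrite /c; ring.
rewrite ler_pM ?invr_ge0// ?mulr_ge0 ?expR_ge0 ?invr_ge0 ?(ltW t0)//.
by rewrite ler_pM ?mulr_ge0 ?expR_ge0 ?invr_ge0 ?(ltW t0).
Qed.

End NonIntegrability.

Theorem corollary3p3 (R : realType) (k c x : R) (alpha eta lambda v : R[i])
  (k_gt0 : 0 < k) (x_gt0 : 0 < x)
  (v_gt : -1 < complex.Re v)
  (alpha_gt0 : 0 < complex.Re alpha)
  (lambda_v_gt0 : 0 < complex.Re (lambda + v))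
  (no_pole : ~ nonpos_integer (lambda / k%:C + v / k%:C + eta))
  (lower1 : ~ nonpos_integer (v / k%:C + 1))
  (lower2 : ~ nonpos_integer
     (lambda / (2 * k%:C) + v / (2 * k%:C) + (alpha + eta) / 2))
  (lower3 : ~ nonpos_integer
     (lambda / (2 * k%:C) + v / (2 * k%:C) + (alpha + eta + 1) / 2)) :
  let f := fun t : R => cpow t (lambda / k%:C - 1) * kBessel k v c t in
  (* Convergence of the integral on the left-hand side is not implied by the
     hypotheses: near 0 its integrand is of order
     t^(lambda/k + v/k + eta - 1). *)
  (0 < complex.Re (lambda / k%:C + v / k%:C + eta) ->
     EK_defined eta alpha f x) /\
  (EK_defined eta alpha f x ->
     EK eta alpha f x =
       cpow x (lambda / k%:C + v / k%:C - 1) / cpow (2 * k) (v / k%:C)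
       * (Gamma (lambda / k%:C + v / k%:C + eta)
          / (Gamma (lambda / k%:C + v / k%:C + alpha + eta)
             * Gamma (v / k%:C + 1)))
       * pFq [:: lambda / (2 * k%:C) + v / (2 * k%:C) + eta / 2;
                 lambda / (2 * k%:C) + v / (2 * k%:C) + (eta + 1) / 2]
             [:: v / k%:C + 1;
                 lambda / (2 * k%:C) + v / (2 * k%:C) + (alpha + eta) / 2;
                 lambda / (2 * k%:C) + v / (2 * k%:C) + (alpha + eta + 1) / 2]
             (- (c * x ^+ 2 / (4 * k)))%:C).
Proof.
move=> f; set b := v / k%:C + 1; pose m := lambda / k%:C + v / k%:C + eta.
pose y := - c / (4 * k).
have kC : k%:C != 0 := real_complex_neq0 _ (lt0r_neq0 k_gt0).
have k4 : 4 * k != 0 by rewrite mulf_neq0 ?gt_eqF.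
pose K := (cpow (2 * k) (v / k%:C) * Gamma b)^-1.
have K0 : K != 0.
  by rewrite invr_neq0 // mulf_neq0; [|exact: cpow_neq0|exact: Gamma_neq0].
have mI : measurable (`]0, x[%classic : set R) by exact: measurable_itv.
have fE : {in (`]0, x[%classic : set R), EK_integrand eta alpha f x =1
    (fun t => K * bessel_kernel alpha m b y x t)}.
  move=> t; rewrite inE /= in_itv/= => /andP[t0 tx].
  rewrite /EK_integrand /f (kBesselE _ _ _ _ k_gt0 t0 lower1) -/b -/y -/K /bessel_kernel.
  have -> : cpow t (m - 1) =
      cpow t eta * (cpow t (lambda / k%:C - 1) * cpow t (v / k%:C)).
    by rewrite -!cpowD; congr cpow; rewrite /m; ring.
  move: {K0} K (bessel_sum _ _ _) (cpow _ _) (cpow _ _) (cpow _ _) (cpow _ _).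
  by move=> *; ring.
split => [m0|].
  have [ik _] := cintegral_bessel_kernel alpha m b y x alpha_gt0 m0 x_gt0 lower1.
  apply: (eq_cintegrable _ _ _ mI _ (cintegrableZ _ K _ mI ik)) => t tI.
  by rewrite fE.
move=> iE.
have ik : cintegrable `]0, x[%classic (bessel_kernel alpha m b y x).
  apply: (eq_cintegrable _ _ _ mI _ (cintegrableZ _ K^-1 _ mI iE)) => t tI.
  by rewrite (fE _ tI) mulrA (mulVf K0) mul1r.
have m0 := bessel_kernel_integrable_gt0 _ _ _ _ _ x_gt0 lower1 ik.
have [_ E] := cintegral_bessel_kernel alpha m b y x alpha_gt0 m0 x_gt0 lower1.
have am0 : 0 < Rpart (alpha + m) by rewrite RpartD addr_gt0.
rewrite /EK (eq_cintegral _ _ _ fE) (cintegralZ _ _ _ mI ik) E.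
rewrite -(Gamma_gt0E _ alpha_gt0) -(Gamma_gt0E _ m0) -(Gamma_gt0E _ am0).
have -> : lambda / k%:C + v / k%:C + alpha + eta = alpha + m by rewrite /m; ring.
have -> : lambda / (2 * k%:C) + v / (2 * k%:C) + eta / 2 = m / 2.
  by rewrite /m; field.
have -> : lambda / (2 * k%:C) + v / (2 * k%:C) + (eta + 1) / 2 = (m + 1) / 2.
  by rewrite /m; field.
have -> : lambda / (2 * k%:C) + v / (2 * k%:C) + (alpha + eta) / 2 = (alpha + m) / 2.
  by rewrite /m; field.
have -> : lambda / (2 * k%:C) + v / (2 * k%:C) + (alpha + eta + 1) / 2 =
    (alpha + m + 1) / 2.
  by rewrite /m; field.
have -> : - (c * x ^+ 2 / (4 * k)) = y * x ^+ 2 by rewrite /y !mulNr mulrAC.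
have -> : cpow x (lambda / k%:C + v / k%:C - 1) =
    cpow x (- alpha - eta) * cpow x (alpha + m - 1).
  by rewrite -cpowD; congr cpow; rewrite /m; ring.
have Ga := Gamma_neq0 alpha (not_nonpos_integer_gt0 _ alpha_gt0).
rewrite /K -/m -/b.
move: (pFq _ _ _) (Gamma alpha) (Gamma m) (Gamma (alpha + m)) (Gamma b) Ga.
move: (cpow x _) (cpow x _) (cpow (2 * k) _) => q1 q2 q3 F G1 G2 G3 G4 G1_neq0.
rewrite !invfM; move: (G3^-1) (G4^-1) (q3^-1) => i3 i4 i5.
by field.
Qed.
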